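(* Let $\mu>0$ be an arbitrarily small constant. For $n$-vertex graphs $G$ with diversity $D$ and maximum clique size $S$, with $S$ sufficiently large, and for every integer $x$ with $1\le x\le o(\log S)$, there is a deterministic distributed algorithm in the LOCAL model that computes a proper vertex coloring of $G$ with $(1+\mu)\,S\cdot D^{x+1}$ colors within $\tilde O\big(x\cdot\sqrt{D\cdot S^{1/(x+1)}}\big)+O(\log^* n)$ rounds.
   Context: LOCAL model: the input graph is the communication network; each vertex is a processor with a unique ID of $O(\log n)$ bits and unbounded local computation; computation proceeds in synchronous rounds, in each of which every vertex may send a message of arbitrary size to each neighbor; running time is the number of rounds until all vertices terminate. Global parameters are assumed known to all vertices. The diversity of a vertex is the number of maximal cliques containing it; $D(G)$ is the maximum over all vertices. $\tilde O(f)$ hides factors polylogarithmic in the maximum degree of $G$. *)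

(* Defs.v *)
From mathcomp Require Import all_boot.
From Stdlib Require Import Reals.

Set Implicit Arguments.
Unset Strict Implicit.
Unset Printing Implicit Defensive.

(* A graph whose vertices carry distinct IDs from {0,..,N-1}: the vertex set
   is a subset of 'I_N and the vertex itself is its ID. *)
Record graph (N : nat) := Graph { gV : {set 'I_N}; gE : rel 'I_N }.

Definition simple_graph N (G : graph N) : Prop :=
  (forall u v, gE G u v = gE G v u) /\
  (forall u, ~~ gE G u u) /\
  (forall u v, gE G u v -> (u \in gV G) && (v \in gV G)).

Fixpoint ball N (G : graph N) (r : nat) (v : 'I_N) : {set 'I_N} :=
  match r with
  | 0 => if v \in gV G then [set v] else set0
  | r'.+1 => ball G r' v :|: [set u | [exists w in ball G r' v, gE G w u]]
  end.

(* What vertex v knows after r synchronous LOCAL rounds: the IDs of all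
   vertices within distance r, and all edges incident to vertices within
   distance r-1. *)
Definition same_view N (G1 G2 : graph N) (r : nat) (v : 'I_N) : Prop :=
  ball G1 r v = ball G2 r v /\
  (forall k, k.+1 <= r -> forall u w, u \in ball G1 k v -> gE G1 u w = gE G2 u w).

Definition clique N (G : graph N) (K : {set 'I_N}) : bool :=
  (K \subset gV G) && [forall u in K, forall w in K, (u != w) ==> gE G u w].

Definition maximal_clique N (G : graph N) (K : {set 'I_N}) : bool :=
  clique G K && [forall u in gV G :\: K, ~~ clique G (u |: K)].

Definition vertex_diversity N (G : graph N) (v : 'I_N) : nat :=
  #|[set K : {set 'I_N} | maximal_clique G K & v \in K]|.

Definition diversity N (G : graph N) : nat :=
  \max_(v in gV G) vertex_diversity G v.

Definition clique_number N (G : graph N) : nat :=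
  \max_(K : {set 'I_N} | clique G K) #|K|.

Definition max_degree N (G : graph N) : nat :=
  \max_(v in gV G) #|[set u in gV G | gE G v u]|.

Definition proper_coloring N (G : graph N) (col : 'I_N -> nat) (k : nat) : Prop :=
  (forall v, v \in gV G -> col v < k) /\
  (forall u v, u \in gV G -> v \in gV G -> gE G u v -> col u <> col v).

(* A deterministic r-round LOCAL algorithm on a class P of graphs (all global
   parameters being known, they are fixed by P): its output at v depends only
   on the radius-r view of v. *)
Definition local_algorithm N (P : graph N -> Prop) (r : nat)
  (alg : graph N -> 'I_N -> nat) : Prop :=
  forall G1 G2 v, P G1 -> P G2 -> v \in gV G1 -> same_view G1 G2 r v ->
    alg G1 v = alg G2 v.

Fixpoint log_star_aux (fuel n : nat) : nat :=
  match fuel with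
  | 0 => 0
  | f.+1 => if n <= 1 then 0 else (log_star_aux f (trunc_log 2 n)).+1
  end.
Definition log_star (n : nat) : nat := log_star_aux n n.

Definition little_o_log (g : nat -> nat) : Prop :=
  forall eps : R, (0 < eps)%R -> exists M : nat, forall s : nat, M <= s ->
    (INR (g s) <= eps * ln (INR s))%R.

Definition graph_class N (n Delta D S : nat) (G : graph N) : Prop :=
  simple_graph G /\ #|gV G| = n /\ max_degree G = Delta /\
  diversity G = D /\ clique_number G = S.

(* Main.v *)
Require Import Defs.
From mathcomp Require Import all_boot all_algebra all_field zify.

Set Implicit Arguments.
Unset Strict Implicit.
Unset Printing Implicit Defensive.

(** Fix t with t^y >= S and y <= x + 1. Rank the vertices inside each maximal
    clique and read the ranks in base t. In phase i, join two adjacent vertices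
    that received equal colours so far if their ranks in some common maximal
    clique agree after deleting the last i + 1 digits. Since the earlier phases
    separate equal ranks with i digits deleted, this graph has degree at most
    D (t - 1), and y phases with (1 + 1/W) D (t - 1) colours each give a proper
    colouring of G with at most (1 + 1/W)^y D^y (t - 1)^y colours, where
    (t - 1)^y < S and W is a large multiple of log S.

    One phase, on a graph of degree d, starts from a colouring psi with poly(d)
    colours (Linial) and assigns to each colour a curve over GF(2^k). Trying the
    values of the curve one after the other splits the graph into about sqrt d
    classes, each oriented with out-degree about sqrt d. The classes are then
    treated in turn: a vertex picks a vertical translate of its curve, inside a
    palette of (1 + 1/W) d points, having many points not used by its neighbours,
    and on it a point off the translates picked by its out-neighbours. *)

(** * Curves over GF(2^k) *)

Lemma eq_bits (L a b : nat) : a < 2 ^ L -> b < 2 ^ L ->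
  (forall j, j < L -> odd (a %/ 2 ^ j) = odd (b %/ 2 ^ j)) -> a = b.
Proof.
elim: L a b => [|L IH] a b; first by rewrite expn0 !ltnS !leqn0 => /eqP-> /eqP->.
move=> aL bL bits.
rewrite (divn_eq a 2) (divn_eq b 2) !modn2.
have := bits 0 isT; rewrite expn0 !divn1 => ->.
congr (_ * _ + _); apply: IH; rewrite ?ltn_divLR // -?expnSr //.
by move=> j jL; rewrite -!divnMA -expnS; apply: bits.
Qed.

Section BitPoly.
Import GRing.Theory.
Local Open Scope ring_scope.
Variable (F : finFieldType) (L : nat).

(** The bits of [psi] sit in degrees 1 to [L]. Degree 0 stays free for the vertical translate, and
    the leading term of degree [L + 1] keeps the curve from being constant even when all bits
    vanish. *)
Definition bit_poly (psi : nat) : {poly F} :=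
  'X * ('X^L + \poly_(j < L) (odd (psi %/ 2 ^ j))%:R).

Lemma size_bit_poly psi : size (bit_poly psi) = L.+2.
Proof.
have szX : size ('X^L + \poly_(j < L) (odd (psi %/ 2 ^ j))%:R : {poly F}) = L.+1.
  by rewrite size_polyDl size_polyXn // ltnS size_poly.
by rewrite /bit_poly mulrC size_mulX ?szX // -size_poly_gt0 szX.
Qed.

Lemma bit_poly_root_const psi (c : F) (rs : seq F) :
  uniq rs -> all (fun a => (bit_poly psi).[a] == c) rs -> (size rs <= L.+1)%N.
Proof.
move=> urs ars.
have sz : size (bit_poly psi - c%:P) = L.+2.
  rewrite size_polyDl ?size_bit_poly // size_polyN.
  by apply: leq_ltn_trans (size_polyC_leq1 _) _.
rewrite -ltnS -sz; apply: max_poly_roots => //.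
  by rewrite -size_poly_gt0 sz.
apply: sub_all ars => a /eqP pa.
by rewrite /root hornerD hornerN hornerC pa subrr.
Qed.

Lemma bit_poly_agree psi psi' (c : F) (rs : seq F) :
  (psi < 2 ^ L)%N -> (psi' < 2 ^ L)%N -> psi <> psi' ->
  uniq rs -> all (fun a => (bit_poly psi).[a] == (bit_poly psi').[a] + c) rs ->
  (size rs <= L.+1)%N.
Proof.
move=> h h' ne urs ars.
pose p := bit_poly psi - bit_poly psi' - c%:P.
have sz : (size p <= L.+2)%N.
  rewrite (leq_trans (size_polyD _ _)) // size_polyN geq_max.
  rewrite (leq_trans (size_polyC_leq1 _)) // andbT.
  by rewrite (leq_trans (size_polyD _ _)) // size_polyN !size_bit_poly maxnn.
rewrite -ltnS; apply: leq_trans sz; apply: max_poly_roots => //; last first.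
  apply: sub_all ars => a /eqP pa.
  by rewrite /root /p !(hornerD, hornerN, hornerC) pa addrAC addrK subrr.
(* The coefficient of degree [j + 1] of [p] is the difference of the two [j]-th bits, since [c]
   touches only degree 0; so [p = 0] would make all bits agree. *)
apply/eqP => p0; apply: ne; apply: (eq_bits h h') => j jL.
have := congr1 (fun q : {poly F} => q`_j.+1) p0.
rewrite /p /bit_poly coef0 !coefB coefC /= subr0 !(coefXM, coefD, coef_poly) /= jL.
rewrite !coefXn opprD addrACA subrr add0r => /eqP; rewrite subr_eq0.
by case: (odd _) (odd _) => [] [] //; rewrite ?(eq_sym 0) oner_eq0.
Qed.

End BitPoly.

(** [e psi c a] is the height over [a] of the curve of [psi] translated by [c]. In order: translates
    of one curve are disjoint, a curve meets a horizontal line rarely, and curves of different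
    colours meet rarely however they are translated. *)
Definition poly_family (L q : nat) (e : nat -> 'I_q -> 'I_q -> 'I_q) : Prop :=
  [/\ forall psi a, injective (fun c => e psi c a),
      forall psi c y, #|[set a | e psi c a == y]| <= L.+1
    & forall psi psi' c c', psi < 2 ^ L -> psi' < 2 ^ L -> psi <> psi' ->
        #|[set a | e psi c a == e psi' c' a]| <= L.+1].

Lemma poly_family_exists (L k : nat) : 0 < k ->
  exists e : nat -> 'I_(2 ^ k) -> 'I_(2 ^ k) -> 'I_(2 ^ k), poly_family L e.
Proof.
move=> k0; have [F _ cF] := PrimePowerField (isT : prime 2) k0.
pose h (x : F) : 'I_(2 ^ k) := cast_ord cF (enum_rank x).
pose g (i : 'I_(2 ^ k)) : F := enum_val (cast_ord (esym cF) i).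
have hK : cancel h g by move=> x; rewrite /g /h cast_ordK enum_rankK.
have gK : cancel g h by move=> x; rewrite /g /h enum_valK cast_ordKV.
have hI := can_inj hK; have gI := can_inj gK.
have sz (A : {set 'I_(2 ^ k)}) (Q : pred F) :
  (forall a, a \in A -> Q (g a)) ->
  exists2 rs : seq F, uniq rs && all Q rs & #|A| = size rs.
  move=> AQ; exists (map g (enum A)); last by rewrite size_map cardE.
  rewrite map_inj_uniq // enum_uniq; apply/allP => _ /mapP [a aA ->].
  by apply: AQ; rewrite mem_enum in aA.
exists (fun psi c a => h ((bit_poly F L psi).[g a] + g c)%R); split.
- by move=> psi a c c' /hI /GRing.addrI /gI.
- move=> psi c y.
  have [a|rs /andP[u al] ->] :=
    sz [set a | h ((bit_poly F L psi).[g a] + g c)%R == y]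
       (fun x => (bit_poly F L psi).[x] == g y - g c)%R.
    by rewrite inE => /eqP <-; rewrite hK GRing.addrK.
  exact: bit_poly_root_const al.
- move=> psi psi' c c' l l' ne.
  have [a|rs /andP[u al] ->] :=
    sz [set a | h ((bit_poly F L psi).[g a] + g c)%R
                == h ((bit_poly F L psi').[g a] + g c')%R]
       (fun x => (bit_poly F L psi).[x] == (bit_poly F L psi').[x] + (g c' - g c))%R.
    by rewrite inE => /eqP/hI E; rewrite GRing.addrA -E GRing.addrK.
  exact: bit_poly_agree l l' ne u al.
Qed.

(** * Views and locality *)

(** The locality condition of [local_algorithm] for values of any type, so that the whole state of a
    simulation can be tracked. *)
Definition local_fun N (P : graph N -> Prop) (r : nat) (T : Type)
    (f : graph N -> 'I_N -> T) : Prop :=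
  forall G1 G2 v, P G1 -> P G2 -> v \in gV G1 -> same_view G1 G2 r v ->
    f G1 v = f G2 v.

Section Views.
Variable N : nat.
Implicit Types (G : graph N) (u v w : 'I_N).

Lemma ball_center G r v : v \in gV G -> v \in ball G r v.
Proof. by move=> vG; elim: r => [|r IH] /=; rewrite ?vG ?inE // IH. Qed.

Lemma ball_out G r v : v \notin gV G -> ball G r v = set0.
Proof.
move=> /negbTE vG; elim: r => [|r IH] /=; first by rewrite vG.
rewrite IH set0U; apply/setP => u; rewrite !inE.
by apply/negbTE/existsP => -[w]; rewrite inE.
Qed.

Lemma ballSP G r v w : reflect (w \in ball G r v \/ exists2 u, u \in ball G r v & gE G u w)
  (w \in ball G r.+1 v).
Proof.
rewrite /= !inE; apply: (iffP orP) => -[->|h]; try by left.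
  by case/existsP: h => u /andP[]; right; exists u.
by case: h => u uv E; right; apply/existsP; exists u; rewrite uv.
Qed.

Lemma ball_step G r v u w : u \in ball G r v -> gE G u w -> w \in ball G r.+1 v.
Proof.
by move=> uv E; apply/ballSP; right; exists u.
Qed.

Lemma ball_sub_succ G r v : ball G r v \subset ball G r.+1 v.
Proof. exact: subsetUl. Qed.

Lemma ball_nbr G r v u : simple_graph G -> gE G v u ->
  ball G r u \subset ball G r.+1 v.
Proof.
move=> [_ [_ sV]] E; have /andP[vG uG] := sV _ _ E.
elim: r => [|r IH].
  by rewrite {1}/ball uG sub1set (ball_step _ E) // ball_center.
apply/subsetP => w /ballSP[/(subsetP IH) h|[z /(subsetP IH) zv]].
  exact: (subsetP (ball_sub_succ _ _ _)).
exact: ball_step.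
Qed.

(** A ball is empty precisely when its centre is not a vertex, so the view reveals membership. *)
Lemma same_view_gV G1 G2 r v : same_view G1 G2 r v -> v \in gV G1 -> v \in gV G2.
Proof.
move=> [Eb _] vG; apply/negPn/negP => /(ball_out r) B2.
by have := ball_center r vG; rewrite Eb B2 inE.
Qed.

(** Balls are grown from edges, so agreement of views only has to be checked on edges. *)
Lemma ball_eq_edges G1 G2 r v : v \in gV G1 -> v \in gV G2 ->
  (forall k, k < r -> forall u w, u \in ball G1 k v -> gE G1 u w = gE G2 u w) ->
  ball G1 r v = ball G2 r v.
Proof.
move=> v1 v2; elim: r => [|r IH] Ee; first by rewrite /= v1 v2.
have {}IH : ball G1 r v = ball G2 r v by apply: IH => k kr; apply: Ee; apply: ltnW.
rewrite /= -IH; congr (_ :|: _); apply/setP => u; rewrite !inE.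
by apply: eq_existsb => w; case wb: (w \in _) => //=; apply: Ee wb.
Qed.

Lemma same_view_leq G1 G2 r s v : v \in gV G1 -> r <= s ->
  same_view G1 G2 s v -> same_view G1 G2 r v.
Proof.
move=> v1 rs sv; have v2 := same_view_gV sv v1; case: sv => _ Ee.
have Er k : k < r -> forall u w, u \in ball G1 k v -> gE G1 u w = gE G2 u w.
  by move=> kr; apply: Ee; apply: leq_trans rs.
by split=> //; apply: ball_eq_edges.
Qed.

Lemma same_view_edge G1 G2 r v u : v \in gV G1 -> same_view G1 G2 r.+1 v ->
  gE G1 v u = gE G2 v u.
Proof. by move=> v1 [_ /(_ 0 isT v u)]; rewrite /= v1 inE eqxx; apply. Qed.

(** The ball of radius [k] around a neighbour lies in the ball of radius [k + 1] around [v]; hence a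
    round costs one unit of radius. *)
Lemma same_view_nbr G1 G2 r v u : simple_graph G1 -> simple_graph G2 ->
  gE G1 v u -> same_view G1 G2 r.+1 v -> same_view G1 G2 r u.
Proof.
move=> s1 s2 E1 sv; have /andP[v1 u1] := s1.2.2 _ _ E1.
have E2 := E1; rewrite (same_view_edge u v1 sv) in E2.
have /andP[v2 u2] := s2.2.2 _ _ E2.
have Er k : k < r -> forall x w, x \in ball G1 k u -> gE G1 x w = gE G2 x w.
  move=> kr x w xu; case: sv => _ /(_ k.+1 kr x w); apply.
  exact: (subsetP (ball_nbr _ s1 E1)).
by split=> //; apply: ball_eq_edges.
Qed.

End Views.

Section Locality.
Variables (N : nat) (P : graph N -> Prop).
Hypothesis P_simple : forall G, P G -> simple_graph G.
Implicit Types (G : graph N) (nb : graph N -> 'I_N -> {set 'I_N}).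

Lemma local_fun_leq r s T (f : graph N -> 'I_N -> T) : r <= s ->
  local_fun P r f -> local_fun P s f.
Proof.
by move=> rs lf G1 G2 v p1 p2 v1 sv; apply: lf => //; apply: same_view_leq sv.
Qed.

(** The graph to be coloured is a subgraph of [G] that is itself computed in [r] rounds; messages
    still travel along the edges of [G]. *)
Record local_subgraph (r Dl : nat) nb : Prop := LocalSubgraph {
  lsg_edge : forall G u v, P G -> u \in nb G v -> gE G v u;
  lsg_sym : forall G u v, P G -> u \in nb G v -> v \in nb G u;
  lsg_deg : forall G v, P G -> v \in gV G -> #|nb G v| <= Dl;
  lsg_local : local_fun P r nb }.

Record local_coloring (r : nat) nb (m : nat) (psi : graph N -> 'I_N -> nat) : Prop :=
  LocalColoring {
    lc_bound : forall G v, P G -> v \in gV G -> psi G v < m;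
    lc_proper : forall G u v, P G -> u \in nb G v -> psi G u <> psi G v;
    lc_local : local_fun P r psi }.

Lemma lsg_gVl r Dl nb G u v : local_subgraph r Dl nb -> P G -> u \in nb G v ->
  v \in gV G.
Proof.
by move=> sg p /(lsg_edge sg p) E; have /andP[] := (P_simple p).2.2 _ _ E.
Qed.

Lemma lsg_gVr r Dl nb G u v : local_subgraph r Dl nb -> P G -> u \in nb G v ->
  u \in gV G.
Proof.
by move=> sg p /(lsg_edge sg p) E; have /andP[] := (P_simple p).2.2 _ _ E.
Qed.

Lemma lsg_leq r s Dl nb : r <= s -> local_subgraph r Dl nb -> local_subgraph s Dl nb.
Proof. by move=> rs [a b c d]; split=> //; apply: local_fun_leq d. Qed.

Lemma lc_leq r s nb m psi : r <= s ->
  local_coloring r nb m psi -> local_coloring s nb m psi.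
Proof. by move=> rs [a b d]; split=> //; apply: local_fun_leq d. Qed.

(** One synchronous round: [g] is computed from the own state and the states of the neighbours. The
    round counts below rest on this. *)
Lemma local_step r Dl nb T (f : graph N -> 'I_N -> T) T' (g : graph N -> 'I_N -> T') :
  local_subgraph r Dl nb -> local_fun P r f ->
  (forall G1 G2 v, f G1 v = f G2 v -> nb G1 v = nb G2 v ->
     (forall u, u \in nb G1 v -> f G1 u = f G2 u) -> g G1 v = g G2 v) ->
  local_fun P r.+1 g.
Proof.
move=> sg lf lg G1 G2 v p1 p2 v1 sv.
have svr := same_view_leq v1 (leqnSn r) sv.
apply: lg; first exact: lf; first exact: (lsg_local sg).
move=> u uv; apply: lf => //; first exact: lsg_gVr sg p1 uv.
exact: same_view_nbr (P_simple p1) (P_simple p2) (lsg_edge sg p1 uv) sv.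
Qed.

Lemma local_pair r T T' (f : graph N -> 'I_N -> T) (g : graph N -> 'I_N -> T') :
  local_fun P r f -> local_fun P r g -> local_fun P r (fun G v => (f G v, g G v)).
Proof. by move=> lf lg G1 G2 v p1 p2 v1 sv; rewrite (lf G1 G2) ?(lg G1 G2). Qed.

End Locality.

(** Union bound: [n] constraints forbidding [d] points each cannot exhaust [A]. *)
Lemma pick_avoiding (T U : finType) (A : {set T}) (B : {set U}) (bad : U -> {set T})
    (d n : nat) :
  #|B| <= n -> (forall u, u \in B -> #|bad u| <= d) -> n * d < #|A| ->
  exists2 a, a \in A & forall u, u \in B -> a \notin bad u.
Proof.
move=> Bn badd nA.
have cov : #|\bigcup_(u in B) bad u| <= n * d.
  apply: (@leq_trans (\sum_(u in B) d)).
    rewrite (leq_trans _ (leq_sum _ badd)) //.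
    elim/big_rec2: _ => [|u s X _ le]; first by rewrite cards0.
    by apply: leq_trans (leq_card_setU _ _) _; rewrite leq_add2l.
  by rewrite sum_nat_const leq_mul2r Bn orbT.
have /subsetPn[a aA aN] : ~~ (A \subset \bigcup_(u in B) bad u).
  apply/negP => /subset_leq_card; rewrite leqNgt => /negP; apply.
  exact: leq_ltn_trans cov nA.
exists a => // u uB; apply: contra aN => au; apply/bigcupP; by exists u.
Qed.

(** * Linial colour reduction *)

Section Linial.
Variables (N : nat) (P : graph N -> Prop).
Hypothesis P_simple : forall G, P G -> simple_graph G.

(** Each of the at most [Dl] neighbours blocks at most [L + 1] of the [2 ^ k] points of the own
    curve, so some point is off all their curves. Its two coordinates form the new colour. *)
Lemma linial_step r Dl nb L psi k :
  local_subgraph P r Dl nb -> local_coloring P r nb (2 ^ L) psi ->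
  0 < k -> Dl * L.+1 < 2 ^ k ->
  exists psi', local_coloring P r.+1 nb (2 ^ (k + k)) psi'.
Proof.
move=> sg lc k0 kL; have [e [_ _ agree]] := poly_family_exists L k0.
have q0 : 0 < 2 ^ k by rewrite expn_gt0.
pose z := Ordinal q0.
pose good G v (a : 'I_(2 ^ k)) :=
  [forall u in nb G v, e (psi G v) z a != e (psi G u) z a].
pose pt G v := odflt z [pick a | good G v a].
have ptP G v : P G -> v \in gV G -> good G v (pt G v).
  move=> p vG; rewrite /pt; case: pickP => //= no.
  pose bad u := [set a | e (psi G v) z a == e (psi G u) z a].
  have [u uv| |a _ ga] := @pick_avoiding _ _ [set: 'I_(2 ^ k)] (nb G v) bad L.+1 Dl (lsg_deg sg p vG).
  - apply: agree; rewrite ?(lc_bound lc) //; first exact: lsg_gVr sg p uv.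
    exact/nesym/(lc_proper lc p uv).
  - by rewrite cardsT card_ord.
  case/negP: (negbT (no a)); apply/forallP => u; apply/implyP => /ga.
  by rewrite inE.
exists (fun G v => pt G v * 2 ^ k + e (psi G v) z (pt G v)); split.
- move=> G v _ _; rewrite expnD.
  apply: (@leq_trans ((pt G v).+1 * 2 ^ k)); last by rewrite leq_mul2r ltn_ord orbT.
  by rewrite mulSn addnC ltn_add2r.
- move=> G u v p uv E.
  have Ept : pt G u = pt G v.
    apply: val_inj; have := congr1 (divn^~ (2 ^ k)) E.
    by rewrite /= !divnMDl // !divn_small // !addn0.
  have := ptP G v p (lsg_gVl P_simple sg p uv).
  move=> /forallP/(_ u); rewrite uv /= => /eqP; apply; rewrite -Ept.
  by apply: val_inj; apply/eqP; move/eqP: E; rewrite -Ept eqn_add2l eq_sym.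
- apply: (local_step P_simple sg (lc_local lc)) => G1 G2 v Ev En Eu.
  have -> : pt G1 v = pt G2 v; last by rewrite Ev.
  rewrite /pt; congr odflt; apply: eq_pick => a; rewrite /good.
  rewrite -En -Ev; apply: eq_forallb => u; case uv: (u \in _) => //=.
  by rewrite (Eu u uv).
Qed.

(** Length of the colours in bits after [i] steps: [2 ^ k] exceeds the number of blocked points, and
    two coordinates take [k + k] bits. *)
Fixpoint linial_bits (Dl L i : nat) : nat :=
  if i is i'.+1 then
    let k := (trunc_log 2 (Dl * (linial_bits Dl L i').+1)).+1 in k + k
  else L.

Lemma linial_iter r Dl nb L psi i :
  local_subgraph P r Dl nb -> local_coloring P r nb (2 ^ L) psi ->
  exists psi', local_coloring P (r + i) nb (2 ^ linial_bits Dl L i) psi'.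
Proof.
move=> sg lc; elim: i => [|i [psi' IH]]; first by exists psi; rewrite addn0.
rewrite addnS; apply: linial_step IH _ _ => //.
  exact: lsg_leq (leq_addr _ _) sg.
exact: trunc_log_ltn.
Qed.

End Linial.

(** * Arbdefective colouring *)

Lemma double_count (T U : finType) (A : {set T}) (B : {set U}) (R : T -> U -> bool) :
  \sum_(j in A) #|[set u in B | R j u]| = \sum_(u in B) #|[set j in A | R j u]|.
Proof.
have E (V : finType) (C : {set V}) (Q : V -> bool) :
    #|[set u in C | Q u]| = \sum_(u in C) if Q u then 1 else 0.
  by rewrite -big_mkcondr /= sum1dep_card.
rewrite (eq_bigr _ (fun j _ => E U B (R j))) exchange_big /=.
by apply: eq_bigr => u _; rewrite E.
Qed.

Section Arbdefective.
Variables (N : nat) (P : graph N -> Prop).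
Hypothesis P_simple : forall G, P G -> simple_graph G.
Variables (r Dl L q beta : nat) (nb : graph N -> 'I_N -> {set 'I_N}).
Variables (psi : graph N -> 'I_N -> nat) (e : nat -> 'I_q -> 'I_q -> 'I_q) (z : 'I_q).
Hypothesis sg : local_subgraph P r Dl nb.
Hypothesis lc : local_coloring P r nb (2 ^ L) psi.
Hypothesis fam : poly_family L e.
Hypothesis beta_big : Dl * (2 * L.+1) < q * beta.+1.

Let trial G v i := e (psi G v) z (insubd z i).

(** [None] marks an active vertex, [Some (j, b)] one that settled in trial [j] on class [b]. A
    neighbour counts against [b] if it has settled on [b], or is active and trying [b] at the same
    moment. *)
Fixpoint run G i v : option (nat * 'I_q) :=
  if i is j.+1 then
    if run G j v is Some s then Some s else
    let b := trial G v j in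
    if #|[set u in nb G v |
          if run G j u is Some s then s.2 == b else trial G u j == b]| <= beta
    then Some (j, b) else None
  else None.

Let conflict G v j u :=
  if run G j u is Some s then s.2 == trial G v j else trial G u j == trial G v j.

Let run_mono G v s i j : i <= j -> run G i v = Some s -> run G j v = Some s.
Proof.
move=> /subnK <- ri; elim: (j - i) => [|k IH] //.
by rewrite addSn /= IH.
Qed.

Let run_time G v i s : run G i v = Some s ->
  [/\ s.1 < i, run G s.1 v = None, s.2 = trial G v s.1, run G s.1.+1 v = Some s &
      #|[set u in nb G v | conflict G v s.1 u]| <= beta].
Proof.
elim: i => [|i IH] //=; case ri: (run G i v) => [s'|].
  by case=> E; rewrite E in ri; have [lt ? ? ? ?] := IH ri; split=> //; apply: ltnW.
by case: ifP => // le [<-]; split=> //=; rewrite ri le.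
Qed.

(* A neighbour conflicts with at most L + 1 trials of v while it is active, and
   with at most L + 1 trials after it has finalised. *)
Lemma run_total G v : P G -> v \in gV G -> run G q v != None.
Proof.
move=> p vG; apply/eqP => rN.
have cbig (j : 'I_q) : beta < #|[set u in nb G v | conflict G v j u]|.
  have rj : run G j.+1 v = None.
    by case rj: (run G j.+1 v) => [s|] //; rewrite (run_mono _ rj) in rN.
  move: rj => /=; case: (run G j v) => //.
  by case: ifP => // /negbT; rewrite -ltnNge.
(* If [v] stayed active, each of the [q] trials would meet more than [beta] conflicts, too many for
   the double count over neighbours. *)
have : q * beta.+1 <= \sum_(j in [set: 'I_q]) #|[set u in nb G v | conflict G v j u]|.
  rewrite -{1}[q]card_ord -cardsT -sum_nat_const; exact: leq_sum.
rewrite double_count leqNgt => /negP; apply; apply: leq_ltn_trans beta_big.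
apply: (@leq_trans (\sum_(u in nb G v) 2 * L.+1)); last first.
  by rewrite sum_nat_const leq_mul2r (lsg_deg sg p vG) orbT.
apply: leq_sum => u uv; have [_ const agree] := fam.
(* The class in which [u] ends, if any; the default [z] only loosens the upper bound. *)
pose fc := if run G q u is Some s then s.2 else z.
apply: (@leq_trans #|[set a | e (psi G v) z a == fc] :|:
                     [set a | e (psi G v) z a == e (psi G u) z a]|).
  apply/subset_leq_card/subsetP => j; rewrite !inE /= /conflict /trial !valKd.
  case rj: (run G j u) => [s|] /eqP E; last by rewrite E eqxx orbT.
  by rewrite /fc (run_mono _ rj) ?E ?eqxx // ltnW.
apply: leq_trans (leq_card_setU _ _) _; rewrite mul2n -addnn leq_add //.
apply: agree; rewrite ?(lc_bound lc) //; first exact: lsg_gVr sg p uv.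
exact/nesym/(lc_proper lc p uv).
Qed.

(** [psi] belongs to the state because neighbours recompute the current trial from it; each trial
    takes one round. *)
Lemma run_local i : local_fun P (r + i) (fun G v => (psi G v, run G i v)).
Proof.
elim: i => [|i IH].
  by rewrite addn0 => G1 G2 v p1 p2 v1 sv; rewrite (lc_local lc p1 p2 v1 sv).
rewrite addnS; apply: (local_step P_simple (lsg_leq (leq_addr i r) sg) IH).
move=> G1 G2 v [Ep Er] En Eu; congr pair => //=.
rewrite -Er /trial -Ep -En; case: (run G1 i v) => //.
have -> : [set u in nb G1 v | if run G1 i u is Some s
             then s.2 == e (psi G1 v) z (insubd z i)
             else e (psi G1 u) z (insubd z i) == e (psi G1 v) z (insubd z i)] =
          [set u in nb G1 v | if run G2 i u is Some s
             then s.2 == e (psi G1 v) z (insubd z i)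
             else e (psi G2 u) z (insubd z i) == e (psi G1 v) z (insubd z i)] => //.
apply/setP => u; rewrite !inE; case uv: (u \in _) => //=.
by have [-> ->] := Eu u uv.
Qed.

(* [cl G v] is the finalisation time of v with its class; edges inside a class
   point to the endpoint that finalised no later, both ways for equal times. *)
Lemma arbdefective : exists2 cl : graph N -> 'I_N -> nat * 'I_q,
  local_fun P (r + q) cl &
  forall G v, P G -> v \in gV G ->
    #|[set u in nb G v | ((cl G u).2 == (cl G v).2) && ((cl G u).1 <= (cl G v).1)]|
      <= beta.
Proof.
exists (fun G v => odflt (0, z) (run G q v)).
  by move=> G1 G2 v p1 p2 v1 sv; have [_ ->] := run_local p1 p2 v1 sv.
move=> G v p vG; have := run_total p vG.
case rv: (run G q v) => [s|] //= _; have [lt _ Es _ le] := run_time rv.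
apply: leq_trans le; apply/subset_leq_card/subsetP => u; rewrite !inE.
case/andP=> uv; have := run_total p (lsg_gVr P_simple sg p uv).
case ru: (run G q u) => [s'|] //= _ /andP[/eqP E2 le1].
have [_ _ E' ru' _] := run_time ru.
(* When [v] settled, [u] either had settled on this class already, or settled in the same trial and
   was trying the same value. Both were counted as conflicts. *)
rewrite uv /= /conflict; case rs: (run G s.1 u) => [s''|].
  by move: (run_mono (ltnW lt) rs); rewrite ru -Es => -[<-]; rewrite E2.
have Et : s'.1 = s.1.
  apply/eqP; rewrite eqn_leq le1 leqNgt; apply/negP => lt'.
  by rewrite (run_mono lt' ru') in rs.
by rewrite -Et -E' E2 Es -Et eqxx.
Qed.

End Arbdefective.

(** * Colouring the classes in turn *)

Section Sweep.
Variables (N : nat) (P : graph N -> Prop).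
Hypothesis P_simple : forall G, P G -> simple_graph G.
Variables (r Dl L q q1 beta A : nat) (nb : graph N -> 'I_N -> {set 'I_N}).
Variables (psi : graph N -> 'I_N -> nat) (e : nat -> 'I_q -> 'I_q -> 'I_q).
Variables (cl : graph N -> 'I_N -> nat * 'I_q1) (z : 'I_q).
Hypothesis sg : local_subgraph P r Dl nb.
Hypothesis lc : local_coloring P r nb (2 ^ L) psi.
Hypothesis cl_local : local_fun P r cl.
Hypothesis fam : poly_family L e.
Hypothesis Aq : A <= q.
Hypothesis palette_big : Dl + q * (beta * L.+1) < A * q.

Let out G v := [set u in nb G v | ((cl G u).2 == (cl G v).2) && ((cl G u).1 <= (cl G v).1)].
Hypothesis out_deg : forall G v, P G -> v \in gV G -> #|out G v| <= beta.

Let color : Type := ('I_q * 'I_q)%type.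

(** A colour is a point of the grid, and the palette consists of its first [A] columns. *)
Definition free (p : nat) (U : {set color}) (c : 'I_q) : {set 'I_q} :=
  [set a : 'I_q | (a < A) && ((a, e p c a) \notin U)].

(** The translate depends only on the colour and the used points, so a neighbour knowing both can
    reproduce it. *)
Definition shift (p : nat) (U : {set color}) : 'I_q :=
  odflt z [pick c | beta * L.+1 < #|free p U c|].

(* The q translates of one curve cover each point of the palette once, so they
   have few free points on average only if U is large. *)
Lemma shift_free (p : nat) (U : {set color}) : #|U| <= Dl ->
  beta * L.+1 < #|free p U (shift p U)|.
Proof.
move=> UD; rewrite /shift; case: pickP => //= no.
have /negP[] : ~~ (A * q <= Dl + q * (beta * L.+1)) by rewrite -ltnNge.
(* Incidences of translates with [U]: the translates being disjoint, each used point occurs at most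
   once. *)
pose X := [set x : color | (x.2, e p x.1 x.2) \in U].
have XU : #|X| <= Dl.
  apply: leq_trans UD.
  have inj : {in X &, injective (fun x : color => (x.2, e p x.1 x.2))}.
    by have [tr _ _] := fam; case=> c a [c' a'] _ _ /= [<- /tr ->].
  rewrite -(card_in_imset inj); apply/subset_leq_card/subsetP => y.
  by case/imsetP => x xX ->; rewrite inE in xX.
have cX : #|X| = \sum_(c : 'I_q) #|[set a | (a, e p c a) \in U]|.
  rewrite -sum1dep_card (eq_bigr (fun c : 'I_q => \sum_(a | (a, e p c a) \in U) 1)).
    by rewrite pair_big_dep.
  by move=> c _; rewrite sum1dep_card.
have cA : #|[set a : 'I_q | a < A]| = A.
  have Ew : #|[set widen_ord Aq i | i : 'I_A]| = A.
    by rewrite card_imset ?card_ord // => i j /(congr1 val) /= /val_inj.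
  rewrite -[RHS]Ew; apply: eq_card => a; rewrite inE; apply/idP/imsetP => [aA|[i _ ->]]; last exact: (ltn_ord i).
  by exists (Ordinal aA) => //; apply: val_inj.
(* Without a good translate, each one has all but at most [beta * L.+1] of its [A] points used;
   summing over the [q] translates contradicts [palette_big]. *)
have le1 (c : 'I_q) : A <= #|[set a | (a, e p c a) \in U]| + beta * L.+1.
  apply: leq_trans (leq_add (leqnn _) _); last by rewrite leqNgt; apply/negbT/no.
  rewrite -{1}cA; apply: leq_trans (leq_card_setU _ _).
  by apply/subset_leq_card/subsetP => a; rewrite !inE => ->; rewrite orbN.
rewrite mulnC; apply: leq_trans (leq_add XU (leqnn _)); rewrite cX.
have cq (n : nat) : q * n = \sum_(c : 'I_q) n by rewrite sum_nat_const card_ord.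
by rewrite !cq -big_split; apply: leq_sum.
Qed.

Definition used G (f : 'I_N -> option color) v : {set color} :=
  [set y | [exists u in nb G v, f u == Some y]].

(** The point avoids the whole translate of each out-neighbour, whatever point that neighbour picks,
    so a class can choose simultaneously. *)
Let point_ok G v (U : 'I_N -> {set color}) (a : 'I_q) :=
  (a \in free (psi G v) (U v) (shift (psi G v) (U v))) &&
  [forall u in out G v,
     e (psi G v) (shift (psi G v) (U v)) a != e (psi G u) (shift (psi G u) (U u)) a].

Let point G (U : 'I_N -> {set color}) v : 'I_q := odflt z [pick a | point_ok G v U a].

Fixpoint sweep j G v : option color :=
  if j is i.+1 then
    if (cl G v).2 == i :> nat then
      let U := used G (sweep i G) in
      let a := point G U v in Some (a, e (psi G v) (shift (psi G v) (U v)) a)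
    else sweep i G v
  else None.

Lemma used_card G f v : P G -> v \in gV G -> #|used G f v| <= Dl.
Proof.
move=> p vG; apply: leq_trans (lsg_deg sg p vG).
apply: leq_trans (leq_imset_card (fun u => odflt (z, z) (f u)) _).
apply/subset_leq_card/subsetP => y; rewrite inE => /existsP[u /andP[uv /eqP fu]].
by apply/imsetP; exists u => //; rewrite fu.
Qed.

Lemma point_exists G f v : P G -> v \in gV G -> point_ok G v (used G f) (point G (used G f) v).
Proof.
move=> p vG; rewrite /point; case: pickP => //= no.
set c := fun u => shift (psi G u) (used G f u).
pose bad u := [set a | e (psi G v) (c v) a == e (psi G u) (c u) a].
have [u||a aF ab] := @pick_avoiding _ _ (free (psi G v) (used G f v) (c v)) (out G v) bad
  L.+1 beta (out_deg p vG).
- rewrite inE => /andP[uv _]; have [_ _ agree] := fam.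
  apply: agree; rewrite ?(lc_bound lc) //; first exact: lsg_gVr sg p uv.
  exact/nesym/(lc_proper lc p uv).
- exact: shift_free (used_card f p vG).
move/negP: (negbT (no a)); case; rewrite /point_ok aF /=.
by apply/forallP => u; apply/implyP => /ab; rewrite inE.
Qed.

Lemma sweep_bound j G v x : P G -> v \in gV G -> sweep j G v = Some x -> x.1 < A.
Proof.
move=> p vG; elim: j => //= i IH; case: ifP => _ //= [<-] /=.
by have /andP[] := point_exists (sweep i G) p vG; rewrite inE => /andP[].
Qed.

Lemma sweep_some j G v : (cl G v).2 < j -> sweep j G v != None.
Proof.
elim: j => //= i IH; rewrite ltnS; case: (ltngtP (cl G v).2 i) => //.
by move=> lt _; apply: IH.
Qed.

Lemma sweep_proper j G u v x : P G -> u \in nb G v ->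
  sweep j G u = Some x -> sweep j G v <> Some x.
Proof.
move=> p uv.
have vG := lsg_gVl P_simple sg p uv; have uG := lsg_gVr P_simple sg p uv.
have vu := lsg_sym sg p uv.
elim: j x => //= i IH x.
(* A vertex coloured now takes a free point, hence no colour fixed earlier at a neighbour. *)
have new w w' : P G -> w' \in nb G w -> w \in gV G ->
    (cl G w).2 == i :> nat -> sweep i G w' = Some x ->
    let U := used G (sweep i G) in
    let a := point G U w in (a, e (psi G w) (shift (psi G w) (U w)) a) <> x.
  move=> _ ww wG _ E /= Ex; have /andP[] := point_exists (sweep i G) p wG.
  rewrite inE => /andP[_] /negP[]; rewrite Ex inE; apply/existsP; exists w'.
  by rewrite ww E eqxx.
have both w w' : w \in gV G -> w' \in out G w ->
    let U := used G (sweep i G) in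
    (point G U w', e (psi G w') (shift (psi G w') (U w')) (point G U w')) <>
    (point G U w, e (psi G w) (shift (psi G w) (U w)) (point G U w)).
  move=> wG ww /= [Ea]; have /andP[_ /forallP/(_ w')] := point_exists (sweep i G) p wG.
  by rewrite ww /= -Ea => /eqP ne E; apply: ne.
case: ifP => cu; case: ifP => cv.
- case=> Ex [Ey]; rewrite -Ex in Ey; have Ec : (cl G u).2 = (cl G v).2.
    by apply: val_inj; rewrite /= (eqP cu) (eqP cv).
  (* Finalisation times are comparable, so one endpoint is an out-neighbour of the other. *)
  have [le|le] := leqP (cl G u).1 (cl G v).1.
    by apply: (both v u vG _ (esym Ey)); rewrite inE uv Ec eqxx.
  by apply: (both u v uG _ Ey); rewrite inE vu Ec eqxx ltnW.
- by move=> [Ex] Ey; exact: (new u v p vu uG cu Ey Ex).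
- by move=> Ex [Ey]; exact: (new v u p uv vG cv Ex Ey).
- exact: IH.
Qed.

(** Two rounds per class: one to collect the colours of the neighbours, one to learn their [used]
    sets and thereby their translates. *)
Lemma sweep_local j :
  local_fun P (r + j.*2) (fun G v => (psi G v, cl G v, sweep j G v)).
Proof.
elim: j => [|i IH].
  rewrite addn0 => G1 G2 v p1 p2 v1 sv.
  by rewrite (lc_local lc p1 p2 v1 sv) (cl_local p1 p2 v1 sv).
rewrite doubleS !addnS.
have IH1 : local_fun P (r + i.*2).+1
    (fun G v => (psi G v, cl G v, sweep i G v, used G (sweep i G) v)).
  apply: (local_step P_simple (lsg_leq (leq_addr _ _) sg) IH).
  move=> G1 G2 v [Ep Ec Es] En Eu; rewrite Ep Ec Es; congr pair.
  apply/setP => y; rewrite !inE -En; apply: eq_existsb => u.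
  by case uv: (u \in _) => //=; have [_ _ ->] := Eu u uv.
apply: (local_step P_simple (lsg_leq _ sg) IH1); first by rewrite -addnS leq_addr.
move=> G1 G2 v [Ep Ec Es EU] En Eu /=; rewrite Ep Ec Es.
have Ept : point G1 (used G1 (sweep i G1)) v = point G2 (used G2 (sweep i G2)) v.
  rewrite /point; congr odflt; apply: eq_pick => a; rewrite /point_ok EU Ep.
  congr andb; apply: eq_forallb => u; rewrite !inE -En Ec.
  by case uv: (u \in _) => //=; have [-> -> _ ->] := Eu u uv.
by rewrite Ept EU.
Qed.

End Sweep.

(** Two fields with different roles: [2 ^ k1] is the number of classes and governs the time,
    [2 ^ k2] is the height of the palette. Splitting takes [2 ^ k1] rounds and the sweep twice as
    many. *)
Lemma fast_coloring N (P : graph N -> Prop) r Dl nb L psi k1 k2 A beta :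
  (forall G, P G -> simple_graph G) ->
  local_subgraph P r Dl nb -> local_coloring P r nb (2 ^ L) psi ->
  0 < k1 -> 0 < k2 -> A <= 2 ^ k2 ->
  Dl * (2 * L.+1) < 2 ^ k1 * beta.+1 ->
  Dl + 2 ^ k2 * (beta * L.+1) < A * 2 ^ k2 ->
  exists col, local_coloring P (r + 3 * 2 ^ k1) nb (A * 2 ^ k2) col.
Proof.
move=> Ps sg lc k10 k20 Aq big1 big2.
have [e1 fam1] := poly_family_exists L k10.
have [e2 fam2] := poly_family_exists L k20.
have z1 : 'I_(2 ^ k1) by apply: (@Ordinal _ 0); rewrite expn_gt0.
have z2 : 'I_(2 ^ k2) by apply: (@Ordinal _ 0); rewrite expn_gt0.
have [cl cll clout] := arbdefective Ps z1 sg lc fam1 big1.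
set q1 := 2 ^ k1 in cl cll clout *; set q2 := 2 ^ k2 in Aq big2 e2 fam2 z2 *.
pose fin G v := odflt (z2, z2) (sweep L beta A nb psi e2 cl z2 q1 G v).
have sg' := lsg_leq (leq_addr q1 r) sg.
have lc' := lc_leq (leq_addr q1 r) lc.
have finE G v : P G -> v \in gV G ->
    sweep L beta A nb psi e2 cl z2 q1 G v = Some (fin G v).
  move=> p vG; rewrite /fin; case E: (sweep _ _ _ _ _ _ _ _ _ _ _) => [x|] //.
  by have := sweep_some L beta A nb psi e2 z2 (ltn_ord (cl G v).2); rewrite E.
exists (fun G v => (fin G v).1 * q2 + (fin G v).2); split.
- move=> G v p vG.
  have lt := sweep_bound Ps sg' lc' fam2 Aq big2 clout p vG (finE _ _ p vG).
  apply: (@leq_trans ((fin G v).1.+1 * q2)); last by rewrite leq_mul2r lt orbT.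
  by rewrite mulSn addnC ltn_add2r.
- move=> G u v p uv E.
  have vG := lsg_gVl Ps sg p uv; have uG := lsg_gVr Ps sg p uv.
  apply: (sweep_proper Ps sg' lc' fam2 Aq big2 clout p uv (finE _ _ p uG)).
  rewrite finE //; congr Some; apply/esym; case: (fin G u) (fin G v) E => a b [a' b'] /= E.
  have q20 : 0 < q2 by rewrite expn_gt0.
  have Ea : a = a'.
    apply: val_inj; have := congr1 (divn^~ q2) E.
    by rewrite /= !divnMDl // !divn_small // !addn0.
  rewrite Ea in E *; congr pair; apply: val_inj; apply/eqP.
  by move/eqP: E; rewrite eqn_add2l.
- have := sweep_local Ps beta A e2 z2 sg' lc' cll (j := q1).
  have -> : r + q1 + q1.*2 = r + 3 * q1 by rewrite -addnA -mul2n -mulSn.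
  by move=> loc G1 G2 v p1 p2 v1 sv; rewrite /fin; have [_ _ ->] := loc G1 G2 v p1 p2 v1 sv.
Qed.

(** * Clique decomposition *)

Definition cliques_at N (G : graph N) (v : 'I_N) : {set {set 'I_N}} :=
  [set K | maximal_clique G K & v \in K].

Definition edge_nb N (G : graph N) (v : 'I_N) : {set 'I_N} := [set u | gE G v u].

Section Cliques.
Variable N : nat.
Implicit Types (G : graph N) (u v w : 'I_N) (K : {set 'I_N}).

Lemma cliqueP G K : reflect (K \subset gV G /\
    forall u w, u \in K -> w \in K -> u != w -> gE G u w) (clique G K).
Proof.
apply: (iffP andP) => -[KV KE]; split=> //.
  move=> u w uK wK uw; move/forallP: KE => /(_ u); rewrite uK /= => /forallP/(_ w).
  by rewrite wK uw.
apply/forallP => u; apply/implyP => uK; apply/forallP => w; apply/implyP => wK.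
by apply/implyP; apply: KE.
Qed.

Lemma clique_in_maximal G C : clique G C ->
  exists2 K, maximal_clique G K & C \subset K.
Proof.
case/maxset_exists=> K /maxsetP[Kcl Kmax] sub; exists K => //.
rewrite /maximal_clique Kcl; apply/forallP => x; apply/implyP; rewrite inE.
case/andP=> xK _; apply: contra xK => /Kmax Kx.
by rewrite -(Kx (subsetUr _ _)) setU11.
Qed.

Lemma edge_in_maximal_clique G u w : simple_graph G -> gE G u w ->
  exists K, [/\ maximal_clique G K, u \in K & w \in K].
Proof.
move=> [sym [irr sV]] E; have /andP[uV wV] := sV _ _ E.
have [|K mK /subsetP sub] := @clique_in_maximal G [set u; w].
  apply/cliqueP; split; first by apply/subsetP => x /set2P[] ->.
  by move=> x y /set2P[] -> /set2P[] ->; rewrite ?eqxx // sym.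
by exists K; rewrite !sub ?set21 ?set22.
Qed.

Lemma same_view_sym G1 G2 r v : same_view G1 G2 r v -> same_view G2 G1 r v.
Proof.
move=> [Eb Ee]; split=> // k kr u w.
have [v1|v1] := boolP (v \in gV G1); last first.
  have := ball_out r v1; rewrite Eb => B2 uv.
  have v2 : v \notin gV G2.
    by apply/negP => /(ball_center r); rewrite B2 inE.
  by rewrite (ball_out k v2) inE in uv.
have v2 : v \in gV G2 by exact: same_view_gV (conj Eb Ee) v1.
have Ebk : ball G1 k v = ball G2 k v.
  by apply: ball_eq_edges => // j jk; apply: Ee; apply: ltn_trans kr.
rewrite -Ebk => uv; symmetry; exact: Ee uv.
Qed.

(** A clique through [v] lies in the ball of radius 1, whose incident edges are visible at radius
    2. *)
Lemma clique_same_view G1 G2 K v : simple_graph G2 -> same_view G1 G2 2 v ->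
  v \in K -> clique G1 K -> clique G2 K.
Proof.
move=> [_ [_ sV2]] sv vK /cliqueP[KV KE].
have v1 := subsetP KV _ vK; have v2 := same_view_gV sv v1.
have Kb u : u \in K -> u \in ball G1 1 v.
  move=> uK; apply/ballSP; have [->|uv] := eqVneq u v; first by left; apply: ball_center.
  by right; exists v; [apply: ball_center | apply: KE; rewrite // eq_sym].
have KE2 u w : u \in K -> w \in K -> u != w -> gE G2 u w.
  by move=> uK wK uw; case: sv => _ /(_ 1 isT u w (Kb u uK)) <-; apply: KE.
apply/cliqueP; split=> //; apply/subsetP => u uK.
have [->|uv] := eqVneq u v; first exact: v2.
by have /andP[] := sV2 _ _ (KE2 _ _ uK vK uv).
Qed.

(** Maximality transfers because an extension in [G2] still contains [v] and is therefore a clique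
    of [G1] too. *)
Lemma cliques_at_sub G1 G2 v : simple_graph G1 -> simple_graph G2 ->
  same_view G1 G2 2 v -> cliques_at G1 v \subset cliques_at G2 v.
Proof.
move=> s1 s2 sv; apply/subsetP => K; rewrite !inE => /andP[/andP[Kcl Kmax] vK].
rewrite vK andbT /maximal_clique (clique_same_view s2 sv vK Kcl).
apply/forallP => u; apply/implyP; rewrite inE => /andP[uK _].
apply/negP => /(clique_same_view s1 (same_view_sym sv)).
rewrite !inE vK orbT => /(_ isT) ucl; move/forallP: Kmax => /(_ u).
have /cliqueP[uV _] := ucl.
by rewrite inE uK (subsetP uV) ?setU11 //= ucl.
Qed.

Lemma cliques_at_local (P : graph N -> Prop) :
  (forall G, P G -> simple_graph G) -> local_fun P 2 (@cliques_at N).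
Proof.
move=> Ps G1 G2 v /Ps s1 /Ps s2 v1 sv; apply/eqP; rewrite eqEsubset.
by rewrite !cliques_at_sub //; apply: same_view_sym.
Qed.

(** Ranks follow the IDs, so all members of a clique agree on them without communicating. *)
Definition rank_in K v : nat := #|[set u in K | u < v]|.

Lemma rank_in_lt K v : v \in K -> rank_in K v < #|K|.
Proof.
move=> vK; apply/proper_card/properP; split.
  by apply/subsetP => u; rewrite inE => /andP[].
by exists v => //; rewrite inE ltnn andbF.
Qed.

Lemma rank_in_mono K u v : u \in K -> u < v -> rank_in K u < rank_in K v.
Proof.
move=> uK uv; apply/proper_card/properP; split.
  apply/subsetP => w; rewrite !inE => /andP[-> wu] /=; exact: ltn_trans uv.
by exists u; rewrite !inE uK ?uv ?ltnn.
Qed.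

Lemma rank_in_inj K u v : u \in K -> v \in K -> rank_in K u = rank_in K v -> u = v.
Proof.
move=> uK vK E; apply: val_inj; case: (ltngtP (val u) (val v)) => // lt.
  by have := rank_in_mono uK lt; rewrite E ltnn.
by have := rank_in_mono vK lt; rewrite E ltnn.
Qed.

Lemma edge_nb_subgraph (P : graph N -> Prop) Delta :
  (forall G, P G -> simple_graph G) -> (forall G, P G -> max_degree G = Delta) ->
  local_subgraph P 1 Delta (@edge_nb N).
Proof.
move=> Ps Pd; split.
- by move=> G u v _; rewrite inE.
- by move=> G u v p; rewrite !inE (Ps _ p).1.
- move=> G v p vG; rewrite -(Pd _ p).
  rewrite /max_degree; apply: leq_trans (leq_bigmax_cond _ vG).
  apply/subset_leq_card/subsetP => u; rewrite !inE => E; rewrite E andbT.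
  by have /andP[] := (Ps _ p).2.2 _ _ E.
- move=> G1 G2 v p1 p2 v1 sv; apply/setP => u; rewrite !inE.
  exact: same_view_edge sv.
Qed.

End Cliques.

(* Phase i separates vertices whose ranks in a common maximal clique agree
   after deleting the last i + 1 base-t digits; by the earlier phases, equally
   coloured vertices of a clique already differ after deleting i digits. *)
Section Phases.
Variables (N n Delta D S t : nat).
Let P := @graph_class N n Delta D S.
Hypothesis t_gt0 : 0 < t.

Let Ps G : P G -> simple_graph G. Proof. by case. Qed.

Definition phase_nb (i : nat) (acc : graph N -> 'I_N -> nat) G v : {set 'I_N} :=
  [set u in edge_nb G v | (acc G u == acc G v) &&
     [exists K in cliques_at G v,
        (u \in K) && (rank_in K u %/ t ^ i.+1 == rank_in K v %/ t ^ i.+1)]].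

(** Invariant of the phases: for [i = 0] it holds by injectivity of ranks, and once [t ^ i >= S] it
    says that [acc] is injective on every maximal clique. *)
Definition separated (i : nat) (acc : graph N -> 'I_N -> nat) : Prop :=
  forall G K u w, P G -> maximal_clique G K -> u \in K -> w \in K ->
    acc G u = acc G w -> rank_in K u %/ t ^ i = rank_in K w %/ t ^ i -> u = w.

(** In each of the at most [D] cliques at [v], the candidates share the digits above position [i],
    so by [separated] they have distinct digits there; [v] itself occupies one of the [t] values. *)
Lemma phase_nb_deg i acc G v : separated i acc -> P G -> v \in gV G ->
  #|phase_nb i acc G v| <= D * t.-1.
Proof.
move=> sep p vG.
pose B (K : {set 'I_N}) := [set u in K | (acc G u == acc G v) &&
                          (rank_in K u %/ t ^ i.+1 == rank_in K v %/ t ^ i.+1)].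
have BK K : K \in cliques_at G v -> #|B K :\ v| <= t.-1.
  rewrite inE => /andP[mK vK].
  have vB : v \in B K by rewrite inE vK !eqxx.
  rewrite -ltnS prednK //.
  have := cardsD1 v (B K); rewrite vB add1n => <-.
  pose f u : 'I_t := Ordinal (ltn_pmod (rank_in K u %/ t ^ i) t_gt0).
  have inj : {in B K &, injective f}.
    move=> u w; rewrite !inE => /and3P[uK /eqP uv /eqP Ru] /and3P[wK /eqP wv /eqP Rw].
    move/(congr1 val) => /= Em; apply: sep p mK uK wK _ _; first by rewrite uv.
    rewrite (divn_eq (rank_in K u %/ t ^ i) t) (divn_eq (rank_in K w %/ t ^ i) t) Em.
    by rewrite -!divnMA -expnSr Ru Rw.
  by rewrite -(card_in_imset inj) -[X in _ <= X](card_ord t) max_card.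
apply: (@leq_trans #|\bigcup_(K in cliques_at G v) (B K :\ v)|).
  apply/subset_leq_card/subsetP => u; rewrite !inE => /and3P[E a /existsP[K]].
  case/and3P=> Kv uK R; apply/bigcupP; exists K => //; rewrite !inE uK a R !andbT.
  by apply: contraL E => /eqP ->; case: (Ps p) => _ [].
apply: (@leq_trans (\sum_(K in cliques_at G v) t.-1)).
  rewrite (leq_trans _ (leq_sum _ BK)) //.
  elim/big_rec2: _ => [|K s X _ le]; first by rewrite cards0.
  by apply: leq_trans (leq_card_setU _ _) _; rewrite leq_add2l.
rewrite sum_nat_const leq_mul2r; apply/orP; right.
have <- : diversity G = D by case: p => _ [_ [_ []]].
rewrite /diversity; apply: leq_trans (leq_bigmax_cond _ vG); exact: leqnn.
Qed.

(** Radius 2 shows the maximal cliques; the additional round reads the colours of the neighbours. *)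
Lemma phase_nb_subgraph r i acc : 2 <= r -> local_fun P r acc -> separated i acc ->
  local_subgraph P r.+1 (minn Delta (D * t.-1)) (phase_nb i acc).
Proof.
move=> r2 lacc sep.
have sg : local_subgraph P 1 Delta (@edge_nb N).
  by apply: edge_nb_subgraph => // G [_ [_ []]].
split.
- by move=> G u v _; rewrite !inE => /andP[].
- move=> G u v p; rewrite !inE => /and3P[E /eqP -> /existsP[K]].
  rewrite inE => /and3P[/andP[mK vK] uK /eqP R].
  rewrite (Ps p).1 E eqxx; apply/existsP; exists K.
  by rewrite inE mK vK uK R /=.
- move=> G v p vG; rewrite leq_min phase_nb_deg // andbT.
  apply: leq_trans (lsg_deg sg p vG); apply/subset_leq_card/subsetP => u.
  by rewrite inE => /andP[].
- have sgr : local_subgraph P r Delta (@edge_nb N) by apply: lsg_leq sg; apply: ltnW.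
  apply: (local_step Ps sgr (local_pair lacc (local_fun_leq r2 (cliques_at_local Ps)))).
  move=> G1 G2 v [Ea Ec] En Eu; apply/setP => u; rewrite !inE -Ea -Ec.
  move/setP: (En) => /(_ u); rewrite !inE => <-.
  case E: (gE G1 v u) => //=; have /Eu[-> _] : u \in edge_nb G1 v by rewrite inE.
  by [].
Qed.

(** The oracle colours one phase graph in [R] rounds, and forming that graph takes one more. Colours
    of successive phases are the digits of a number in base [M]. *)
Lemma phased_coloring (r0 R M y : nat) :
  2 <= r0 -> S <= t ^ y ->
  (forall r nb, r0 <= r -> local_subgraph P r (minn Delta (D * t.-1)) nb ->
     exists col, local_coloring P (r + R) nb M col) ->
  exists col, local_coloring P (r0 + y * R.+1) (@edge_nb N) (M ^ y) col.
Proof.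
move=> r02 St oracle.
suff [acc [lacc bacc sep]] : exists acc, [/\ local_fun P (r0 + y * R.+1) acc,
    forall G v, P G -> v \in gV G -> acc G v < M ^ y & separated y acc].
  exists acc; split=> // G u v p; rewrite inE => E Eacc.
  have [K [mK vK uK]] := edge_in_maximal_clique (Ps p) E.
  have small w : w \in K -> rank_in K w %/ t ^ y = 0.
    move=> wK; apply: divn_small; apply: leq_trans (rank_in_lt wK) _.
    apply: leq_trans St; have [_ [_ [_ [_ <-]]]] := p.
    by apply: (@leq_bigmax_cond _ _ (fun K : {set 'I_N} => #|K|)); case/andP: mK.
  have Euv : u = v by apply: (sep G K) => //; rewrite !small.
  by move: E; rewrite Euv; apply/negP; case: (Ps p) => _ [].
have sep_gV G K w : P G -> maximal_clique G K -> w \in K -> w \in gV G.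
  by move=> _ /andP[/andP[/subsetP KV _] _] /KV.
clear St; elim: y => [|i [acc [lacc bacc sep]]].
  exists (fun _ _ => 0); split=> // G K u w _ _ uK wK _; rewrite !divn1.
  exact: rank_in_inj.
have r2 : 2 <= r0 + i * R.+1 by apply: leq_trans (leq_addr _ _).
have [||col lc] := oracle (r0 + i * R.+1).+1 (phase_nb i acc).
- by rewrite leqW // leq_addr.
- exact: phase_nb_subgraph.
exists (fun G v => acc G v * M + col G v); split.
- have -> : r0 + i.+1 * R.+1 = (r0 + i * R.+1).+1 + R.
    by rewrite mulSn addnA addnAC addSnnS.
  move=> G1 G2 v p1 p2 v1 sv; rewrite (lc_local lc p1 p2 v1 sv).
  congr (_ * _ + _); apply: (local_fun_leq _ lacc) p1 p2 v1 sv.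
  by rewrite addSn leqW // leq_addr.
- move=> G v p vG; have lt := bacc G v p vG; have ltc := lc_bound lc p vG.
  apply: (@leq_trans ((acc G v).+1 * M)); last by rewrite expnSr leq_mul2r lt orbT.
  by rewrite mulSn addnC ltn_add2r.
- move=> G K u w p mK uK wK E R'.
  have ltu := lc_bound lc p (sep_gV G K u p mK uK).
  have ltw := lc_bound lc p (sep_gV G K w p mK wK).
  have M0 : 0 < M by apply: leq_ltn_trans ltu.
  have Ea : acc G u = acc G w.
    by have := congr1 (divn^~ M) E; rewrite /= !divnMDl // !divn_small // !addn0.
  apply/eqP; apply/negPn/negP => uw.
  have : u \in phase_nb i acc G w.
    rewrite !inE Ea eqxx /=; apply/andP; split.
      by have /andP[/cliqueP[_ KE] _] := mK; apply: KE; rewrite // eq_sym.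
    by apply/existsP; exists K; rewrite inE mK wK uK R' /=.
  move=> /(lc_proper lc p); apply.
  by apply/eqP; move/eqP: E; rewrite Ea eqn_add2l.
Qed.

End Phases.

(** * Inequalities between the graph parameters *)

Section ClassBounds.
Variables (N n Delta D S : nat) (G : graph N).
Hypothesis cls : graph_class n Delta D S G.

Lemma clique_number_attained : exists2 K : {set 'I_N}, clique G K & #|K| = S.
Proof.
have [_ [_ [_ [_ <-]]]] := cls.
have cl0 : clique G set0.
  by apply/cliqueP; split; [apply: sub0set | move=> u w; rewrite inE].
have : 0 < #|[pred K : {set 'I_N} | clique G K]| by apply/card_gt0P; exists set0.
by case/(eq_bigmax_cond (fun K : {set 'I_N} => #|K|)) => K Kcl E; exists K.
Qed.

Lemma class_vertex : 0 < S -> exists v, v \in gV G.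
Proof.
have [K /cliqueP[/subsetP KV _] <-] := clique_number_attained.
by case/card_gt0P=> v /KV vG; exists v.
Qed.

(** A vertex of a largest clique is adjacent to the rest of it. This lets logarithms of [S] be
    absorbed into those of [Delta]. *)
Lemma clique_number_le_degree : 0 < S -> S <= Delta.+1.
Proof.
have [K /cliqueP[/subsetP KV KE] KS] := clique_number_attained.
rewrite -KS => /card_gt0P[v vK].
have [_ [_ [<- _]]] := cls.
rewrite (cardsD1 v) vK add1n ltnS /max_degree.
apply: leq_trans (leq_bigmax_cond _ (KV v vK)).
apply/subset_leq_card/subsetP => u; rewrite !inE => /andP[uv uK].
by rewrite KV // KE // eq_sym.
Qed.

Lemma diversity_gt0 : 0 < S -> 0 < D.
Proof.
case/class_vertex=> v vG; have [_ [_ [_ [<- _]]]] := cls.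
rewrite /diversity; apply: leq_trans (leq_bigmax_cond _ vG).
have cl1 : clique G [set v].
  apply/cliqueP; split; first by rewrite sub1set.
  by move=> u w /set1P -> /set1P ->; rewrite eqxx.
have [K mK sub] := clique_in_maximal cl1.
by apply/card_gt0P; exists K; rewrite inE mK -sub1set.
Qed.

Lemma class_order_gt0 : 0 < S -> 0 < n.
Proof.
case/class_vertex=> v vG; have [_ [<- _]] := cls.
by apply/card_gt0P; exists v.
Qed.

End ClassBounds.

(** * Choice of the parameters *)

Lemma linial_bitsSr Dl L i :
  linial_bits Dl L i.+1 = linial_bits Dl (linial_bits Dl L 1) i.
Proof. by elim: i => // i /= ->. Qed.

Lemma trunc_log_lt_exp x e : 0 < e -> x < 2 ^ e -> trunc_log 2 x < e.
Proof.
move=> e0 lt; case: x lt => [|x] lt; first by rewrite trunc_log0.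
rewrite -(ltn_exp2l _ _ (isT : 1 < 2)); apply: leq_ltn_trans lt.
exact: trunc_logP.
Qed.

Section LogStar.
Variables (alpha Delta : nat).
Let a := 2 ^ alpha.
Let lam := trunc_log 2 (Delta + 2).
Hypothesis a_big : alpha.*2 + 12 <= a.

Let lam_gt0 : 0 < lam.
Proof. by rewrite trunc_log_gt0 // addn2. Qed.

(** Here [k] is at most [2 lam + m + alpha + 4] with [m = trunc_log 2 l]. Doubling gives
    [4 lam + 2 m + 2 alpha + 8], which [a_big] absorbs since [lam >= 1]. *)
Lemma linial_bits_step L l : 0 < l -> L <= a * (lam + l) ->
  linial_bits Delta L 1 <= a * (lam + trunc_log 2 l).
Proof.
move=> l0 Ll /=; set x := Delta * L.+1; set m := trunc_log 2 l.
have Dlt : Delta < 2 ^ lam.+1.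
  by apply: ltn_trans (trunc_log_ltn (Delta + 2) (isT : 1 < 2)); rewrite addn2.
have llt : l < 2 ^ m.+1 by apply: trunc_log_ltn.
have lamlt : lam < 2 ^ lam by apply: ltn_expl.
have a0 : 0 < a by rewrite expn_gt0.
have Lb : L.+1 <= 4 * (a * (lam * l)).
  have h : lam + l <= 2 * (lam * l) by nia.
  have : a * (lam + l) <= a * (2 * (lam * l)) by rewrite leq_mul2l h orbT.
  have : 0 < a * (lam * l) by rewrite !muln_gt0 a0 lam_gt0.
  lia.
have xlt : x < 2 ^ (lam.+1 + (2 + (alpha + (lam + m.+1)))).
  rewrite /x !expnD; apply: (@leq_ltn_trans (Delta * (2 ^ 2 * (2 ^ alpha * (2 ^ lam * 2 ^ m.+1))))).
    rewrite leq_mul2l; apply/orP; right; apply: leq_trans Lb _.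
    by rewrite leq_mul2l leq_mul2l leq_mul ?orbT // ltnW.
  by rewrite ltn_mul2r Dlt !muln_gt0 !expn_gt0.
have := trunc_log_lt_exp _ xlt => /(_ isT).
have : lam * (alpha.*2 + 12) <= a * lam by rewrite [a * lam]mulnC leq_mul2l a_big orbT.
rewrite mulnDr.
have : m * 2 <= a * m by rewrite [a * m]mulnC leq_mul2l (leq_trans _ a_big) ?orbT // addnC.
nia.
Qed.

(** Each step takes one more logarithm of the term depending on [m], until only [a * lam] is
    left. *)
Lemma linial_bits_log_star f m L : m <= f -> L <= a * (lam + trunc_log 2 m) ->
  linial_bits Delta L (log_star_aux f m) <= a * lam.
Proof.
elim: f m L => [|f IH] m L mf Lm.
  by move: mf Lm; rewrite leqn0 => /eqP ->; rewrite trunc_log0 addn0.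
rewrite [log_star_aux _ _]/=; case: ifP => [m1|/negbT].
  by move: Lm; case: m m1 {mf} => [|[|]] // _; rewrite ?trunc_log0 ?trunc_log1 addn0.
rewrite -ltnNge => m1; rewrite linial_bitsSr.
have l0 : 0 < trunc_log 2 m by rewrite trunc_log_gt0 // ltnW.
apply: IH; last exact: linial_bits_step.
rewrite -ltnS; apply: leq_trans mf.
exact: leq_trans (ltn_expl _ (isT : 1 < 2)) (trunc_logP (isT : 1 < 2) (ltnW m1)).
Qed.

End LogStar.

Lemma linial_bits_bound c Delta n : 0 < n ->
  linial_bits Delta (c * (trunc_log 2 n).+1) (log_star n)
    <= 2 ^ (c + 5) * trunc_log 2 (Delta + 2).
Proof.
move=> n0; have cb : c < 2 ^ c by apply: ltn_expl.
apply: linial_bits_log_star => //.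
  by rewrite expnD; change (2 ^ 5) with 32; lia.
have lam0 : 0 < trunc_log 2 (Delta + 2) by rewrite trunc_log_gt0 // addn2.
by rewrite leq_mul //; [rewrite expnD; lia | lia].
Qed.

(** The palette has about [Dl + Dl / W] points. The slack [Dl / W] pays half for rounding down to
    full columns and half for the points lost to out-neighbours. *)
Lemma fast_coloring_params (d W Dl : nat) : 0 < d -> 0 < W -> 32 * W ^ 2 <= Dl ->
  exists k1 k2 A beta,
    [/\ 0 < k1 /\ 0 < k2, A <= 2 ^ k2 /\ W * (A * 2 ^ k2) <= W.+1 * Dl,
        Dl * (2 * d) < 2 ^ k1 * beta.+1, Dl + 2 ^ k2 * (beta * d) < A * 2 ^ k2
      & (2 ^ k2) ^ 2 <= 8 * Dl /\ 2 ^ k1 <= 8 * (W * 2 ^ k2 * d ^ 2)].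
Proof.
move=> d0 W0 WD; have Dl0 : 0 < Dl by apply: leq_trans WD; rewrite muln_gt0 expn_gt0 W0.
(* Least side for which a palette of up to [2 * Dl] points fits into the square grid. *)
have [|k2 qmin k2min] := @ex_minnP (fun k => 2 * Dl <= (2 ^ k) ^ 2).
  exists Dl.+1; have := ltn_expl Dl (isT : 1 < 2); rewrite [2 ^ Dl.+1]expnS -mulnn; set X := 2 ^ Dl; nia.
have k20 : 0 < k2 by case: k2 qmin {k2min} => //; rewrite expn0; lia.
have qmax : (2 ^ k2) ^ 2 <= 8 * Dl.
  case: k2 k20 qmin k2min => // k _ _ kmin; have := kmin k; rewrite ltnn [2 ^ k.+1]expnS.
  by case: leqP => [_ /(_ isT) //|lt _]; move: lt; rewrite -!mulnn; set X := 2 ^ k; nia.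
set q2 := 2 ^ k2 in qmin qmax *.
have q20 : 0 < q2 by rewrite expn_gt0.
(* One column costs at most half the slack; [32 = 4 * 8], where 8 comes from [qmax]. *)
have Wq2 : 2 * (W * q2) <= Dl.
  rewrite -(leq_exp2r _ _ (isT : 0 < 2)) !expnMn.
  apply: (@leq_trans (2 ^ 2 * (W ^ 2 * (8 * Dl)))); first by rewrite !leq_mul2l qmax !orbT.
  by rewrite (expnS Dl 1) expn1; move: WD; rewrite -!mulnn; nia.
pose k1 := (trunc_log 2 (4 * (W * q2 * d ^ 2))).+1.
have q0 : 0 < 4 * (W * q2 * d ^ 2) by rewrite !muln_gt0 W0 q20 d0.
have q1lo : 4 * (W * q2 * d ^ 2) < 2 ^ k1 by apply: trunc_log_ltn.
have q1hi : 2 ^ k1 <= 8 * (W * q2 * d ^ 2).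
  by rewrite /k1 expnS; have := trunc_logP (isT : 1 < 2) q0; lia.
set q1 := 2 ^ k1 in q1lo q1hi.
pose beta := (Dl * (2 * d)) %/ q1.
pose A := (Dl + Dl %/ W) %/ q2.
have q10 : 0 < q1 by rewrite expn_gt0.
have betab : beta * q1 <= Dl * (2 * d) by apply: leq_trunc_div.
have WDW : Dl %/ W * W <= Dl by apply: leq_trunc_div.
have AqM : A * q2 <= Dl + Dl %/ W by apply: leq_trunc_div.
have AqL : Dl + Dl %/ W < A * q2 + q2.
  by rewrite -mulSnr; apply: ltn_ceil.
have DWD : Dl %/ W <= Dl by apply: leq_div.
exists k1, k2, A, beta; rewrite -/q1 -/q2; split=> //.
- split; last by rewrite mulSn; nia.
  by rewrite -(leq_pmul2r q20); move: qmin; rewrite -mulnn; nia.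
- by rewrite [q1 * _]mulnC; apply: ltn_ceil.
- have key : q2 * (beta * d) * W * 2 <= Dl.
    have h : beta * (4 * (W * q2 * d ^ 2)) <= Dl * (2 * d).
      by apply: leq_trans betab; rewrite leq_mul2l ltnW ?orbT.
    rewrite -(leq_pmul2r (_ : 0 < 2 * d)) ?muln_gt0 //.
    apply: leq_trans h; rewrite -mulnn; nia.
  have : q2 + q2 * (beta * d) <= Dl %/ W by rewrite leq_divRL //; nia.
  lia.
Qed.

(** The base is [t = s + 1], the least with [t ^ y >= S]. Capping [y] at [trunc_log B S] keeps the
    base at least [B], so that the phase degrees are large compared with [W]. *)
Lemma phase_params (S x W : nat) : 0 < W -> 32 * W ^ 2 + 2 <= S ->
  exists y s, [/\ 0 < y <= x.+1, y <= trunc_log 2 S, S <= s.+1 ^ y /\ s ^ y <= S,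
     32 * W ^ 2 <= s & s ^ x.+1 <= S \/ s <= (32 * W ^ 2 + 2) ^ 2].
Proof.
move=> W0; set B := 32 * W ^ 2 + 2 => BS.
have B1 : 1 < B by rewrite /B addn2.
have S0 : 0 < S by apply: leq_trans BS; rewrite ltnW.
pose y0 := trunc_log B S.
have y00 : 0 < y0 by rewrite trunc_log_gt0 B1 /= prednK // ltnW.
have By0 : B ^ y0 <= S by apply: trunc_logP.
pose y := minn x.+1 y0.
have yP : 0 < y by rewrite leq_min y00.
have By : B ^ y <= S by apply: leq_trans By0; rewrite leq_exp2l // geq_minr.
have [|t tS tmin] := @ex_minnP (fun t => S <= t ^ y).
  by exists S; rewrite -{1}[S]expn1 leq_pexp2l.
have t0 : 0 < t by case: t tS {tmin} => //; rewrite exp0n // leqNgt S0.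
have tlt : t.-1 ^ y < S.
  by rewrite ltnNge; apply/negP => /tmin; rewrite leqNgt prednK // leqnn.
have Bt : B <= t.
  rewrite leqNgt; apply/negP => tB.
  have : t ^ y < B ^ y by rewrite ltn_exp2r.
  by rewrite ltnNge (leq_trans By tS).
exists y, t.-1; rewrite prednK //; split=> //.
- by rewrite yP geq_minl.
- apply: trunc_log_max => //; apply: leq_trans By; by rewrite leq_exp2r.
- by split=> //; apply: ltnW.
- by rewrite -ltnS prednK //; apply: leq_trans Bt; rewrite /B addn2.
- have [le|lt] := leqP x.+1 y0.
    by left; move: tlt; rewrite /y (minn_idPl le) => /ltnW.
  (* If the cap is active, [S < B ^ (y + 1) <= B ^ (2 * y)], so the base is at most [B ^ 2]. *)
  right; apply: leq_trans (leq_pred _) _; apply: tmin.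
  have Ey : y = y0 by apply/minn_idPr/ltnW.
  rewrite -expnM mul2n Ey; apply: leq_trans (ltnW (trunc_log_ltn S B1)) _.
  by rewrite leq_exp2l // -addnn -addn1 leq_add2l.
Qed.

Lemma polylog_le_pow (c0 l : nat) : 4 * (c0 + 5) <= l ->
  32 * (c0 * l.+1) ^ 2 + 2 <= 2 ^ l.
Proof.
move=> lbig; set m := l %/ 4.
have ml : 4 * m <= l by rewrite mulnC leq_trunc_div.
have lm : l.+1 <= 4 * m.+1 by rewrite mulnC ltn_ceil.
have cm : c0 + 5 <= m by rewrite leq_divRL // mulnC.
apply: (@leq_trans (2 ^ (4 * m))); last by rewrite leq_exp2l.
have c2 : c0 < 2 ^ c0 by apply: ltn_expl.
have m2 : m < 2 ^ m by apply: ltn_expl.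
have c5 : c0.+1 * 32 <= 2 ^ m.
  apply: (@leq_trans (2 ^ (c0 + 5))); last by rewrite leq_exp2l.
  by rewrite expnD leq_mul.
have -> : 4 * m = (m + m) * 2 by lia.
rewrite expnM expnD.
have : c0 * l.+1 * 8 <= 2 ^ m * 2 ^ m.
  apply: (@leq_trans (c0.+1 * 32 * m.+1)); last exact: leq_mul.
  by nia.
have : 32 <= 2 ^ m by apply: leq_trans c5; rewrite mulSn leq_addr.
set X := 2 ^ m; set Y := c0 * l.+1; rewrite -!mulnn => h32 h.
have : 8 * Y * (8 * Y) <= X * X * (X * X) by rewrite leq_mul // mulnC.
have : 1024 <= X * X by rewrite -[1024]/(32 * 32) leq_mul.
nia.
Qed.

(** The IDs are the initial proper colouring, with [c * (trunc_log 2 n).+1] bits. *)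
Lemma linial_coloring N n Delta D S c : 0 < n -> N <= n ^ c ->
  exists psi, local_coloring (@graph_class N n Delta D S) (log_star n).+1 (@edge_nb N)
    (2 ^ (2 ^ (c + 5) * trunc_log 2 (Delta + 2))) psi.
Proof.
move=> n0 Nn; set P := @graph_class N n Delta D S.
have Ps G : P G -> simple_graph G by case.
have sg : local_subgraph P 1 Delta (@edge_nb N).
  by apply: edge_nb_subgraph => // G [_ [_ []]].
have lc0 : local_coloring P 1 (@edge_nb N) (2 ^ (c * (trunc_log 2 n).+1)) (fun _ v => v).
  split=> //.
    move=> G v _ _; apply: leq_trans (ltn_ord v) _; apply: leq_trans Nn _.
    by rewrite mulnC expnM; case: (c) => [|c'] //; rewrite leq_exp2r // ltnW // trunc_log_ltn.
  move=> G u v p; rewrite inE => E /val_inj Euv; move: E; rewrite Euv.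
  by apply/negP; case: (Ps G p) => _ [].
have [psi [b pr loc]] := linial_iter Ps (log_star n) sg lc0.
exists psi; split=> // G v p vG; apply: leq_trans (b G v p vG) _.
by rewrite leq_exp2l // linial_bits_bound.
Qed.

(** The result in integer arithmetic. [Q] is the palette height, of order at most [sqrt (D * s)];
    the last inequality expresses the factor [(1 + 1/W) ^ y] without division, and [c0 * y <= W]
    bounds that factor. *)
Lemma bounded_diversity_coloring (c c0 : nat) : 0 < c0 ->
  exists K S0, forall N n Delta D S x, S0 <= S -> N <= n ^ c ->
  (exists G : graph N, graph_class n Delta D S G) ->
  exists r k W y s Q col,
  [/\ local_coloring (@graph_class N n Delta D S) r (@edge_nb N) k col,
      r <= log_star n + K * (x.+1 * (trunc_log 2 (Delta + 2) ^ 3 * Q)),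
      Q ^ 2 <= 8 * (D * s) /\ (s ^ x.+1 <= S \/ s <= K * trunc_log 2 (Delta + 2) ^ 4),
      0 < W /\ c0 * y <= W
    & W ^ y * k <= W.+1 ^ y * (D ^ x.+1 * S)].
Proof.
move=> c00; pose a := 2 ^ (c + 5).
(* [384 = 6 * 64] comes from [6 * (x.+1 * q1)] rounds and the 64 in the bound on [q1];
   [136 = 34 * 4] from [32 * W ^ 2 + 2 <= 34 * W ^ 2] and [W <= 2 * (c0 * lam)]. *)
exists (384 * (c0 * a ^ 2) + (136 * c0 ^ 2) ^ 2), (2 ^ (4 * (c0 + 5))).
move=> N n Delta D S x Sbig Nn [G0 cls].
set P := @graph_class N n Delta D S; set lam := trunc_log 2 (Delta + 2).
have Ps G : P G -> simple_graph G by case.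
have S0 : 0 < S by apply: leq_trans Sbig; rewrite expn_gt0.
have D0 := diversity_gt0 cls S0; have n0 := class_order_gt0 cls S0.
have SD := clique_number_le_degree cls S0.
have lam0 : 0 < lam by rewrite trunc_log_gt0 // addn2.
pose ls := trunc_log 2 S; pose W := c0 * ls.+1.
have lslam : ls <= lam by apply: leq_trunc_log; rewrite (leq_trans SD) // addn2.
have W0 : 0 < W by rewrite muln_gt0 c00.
have Wlam : W <= 2 * (c0 * lam) by rewrite /W mulnCA leq_mul2l mul2n -addnn -addn1 leq_add ?orbT.
have BS : 32 * W ^ 2 + 2 <= S.
  apply: leq_trans (trunc_logP (isT : 1 < 2) S0); apply: polylog_le_pow.
  exact: trunc_log_max.
have [y [s [/andP[y0 yx] yls [Sy sS] Ws sx]]] := phase_params x W0 BS.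
pose Dl := minn Delta (D * s).
have WD : 32 * W ^ 2 <= Dl.
  rewrite leq_min; apply/andP; split; first by move: SD BS; lia.
  by apply: leq_trans Ws _; rewrite leq_pmull.
pose L := a * lam.
have [psi lc] : exists psi, local_coloring P (log_star n).+1 (@edge_nb N) (2 ^ L) psi.
  exact: linial_coloring.
have [k1 [k2 [A [beta [[k10 k20] [Aq MD] b1 b2 [q2b q1b]]]]]] :=
  fast_coloring_params (ltn0Sn L) W0 WD.
set q1 := 2 ^ k1 in q1b; set q2 := 2 ^ k2 in MD q2b q1b.
have [col lcol] : exists col, local_coloring P ((log_star n).+2 + y * (3 * q1).+1)
    (@edge_nb N) ((A * q2) ^ y) col.
  apply: (@phased_coloring _ _ _ _ _ s.+1) => // r nb rr sg.
  (* [psi] is proper on [G], hence on every phase graph: Linial reduction runs once, which keeps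
     [log_star n] additive. *)
  have lc' : local_coloring P r nb (2 ^ L) psi.
    have [b pr loc] := lc; split=> //.
      by move=> G u v p /(lsg_edge sg p) E; apply: pr => //; rewrite inE.
    by apply: local_fun_leq loc; apply: leq_trans rr.
  exact: fast_coloring sg lc' k10 k20 Aq b1 b2.
exists ((log_star n).+2 + y * (3 * q1).+1), ((A * q2) ^ y), W, y, s, q2, col.
split=> //.
- have q10 : 0 < q1 by rewrite expn_gt0.
  have q1b' : q1 <= 64 * (c0 * a ^ 2) * (lam ^ 3 * q2).
    apply: leq_trans q1b _.
    have Lb : L.+1 <= 2 * (a * lam).
      by rewrite mul2n -addnn -addn1 leq_add // muln_gt0 expn_gt0.
    have Lb2 : L.+1 ^ 2 <= (2 * (a * lam)) ^ 2 by rewrite leq_exp2r.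
    apply: (@leq_trans (8 * (2 * (c0 * lam) * q2 * (2 * (a * lam)) ^ 2))).
      by rewrite leq_mul2l /=; apply: leq_mul Lb2; rewrite leq_mul2r Wlam orbT.
    rewrite (expnS lam 2) -!mulnn; nia.
  apply: (@leq_trans (log_star n + 6 * (x.+1 * q1))).
    rewrite !addSn -!addnS leq_add2l.
    have : y * (3 * q1).+1 <= x.+1 * (4 * q1).
      by apply: leq_mul => //; rewrite mulSn -add1n leq_add2r.
    have : 0 < x.+1 * q1 by rewrite muln_gt0 q10.
    lia.
  rewrite leq_add2l; set T := lam ^ 3 * q2 in q1b' *.
  rewrite mulnDl; apply: leq_trans (leq_addr _ _).
  apply: (@leq_trans (6 * (x.+1 * (64 * (c0 * a ^ 2) * T)))).
    by rewrite !leq_mul2l q1b' !orbT.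
  by rewrite leq_eqVlt; apply/orP; left; apply/eqP; lia.
- split.
    by apply: leq_trans q2b _; rewrite leq_mul2l geq_minr orbT.
  case: sx => [|sB]; [by left | right].
  apply: leq_trans sB _; rewrite mulnDl; apply: leq_trans (leq_addl _ _).
  have -> : lam ^ 4 = (lam ^ 2) ^ 2 by rewrite -expnM.
  rewrite -expnMn leq_exp2r //.
  have : W ^ 2 <= (2 * (c0 * lam)) ^ 2 by rewrite leq_exp2r.
  rewrite -!mulnn; have : 0 < W * W by rewrite muln_gt0 W0.
  nia.
- by split=> //; rewrite leq_mul2l (leq_trans yls) // orbT.
- rewrite -expnMn; apply: (@leq_trans ((W.+1 * (D * s)) ^ y)).
    rewrite leq_exp2r //; apply: leq_trans MD _.
    by rewrite leq_mul2l geq_minr orbT.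
  rewrite !expnMn !leq_mul2l; apply/orP; right; apply: leq_mul => //.
  by rewrite leq_pexp2l.
Qed.

(* From here on, [^] on [nat] is [Nat.pow] and [%R] refers to the reals. *)
From Stdlib Require Import Reals Lra.

(** * Passage to real bounds *)

Lemma pow_expn m n : Nat.pow m n = expn m n.
Proof. by elim: n => // n IH; rewrite expnS -IH. Qed.

Lemma INR_addn m n : INR (m + n) = (INR m + INR n)%R.
Proof. by rewrite -plusE plus_INR. Qed.

Lemma INR_muln m n : INR (m * n) = (INR m * INR n)%R.
Proof. by rewrite -multE mult_INR. Qed.

Lemma INR_expn m n : INR (expn m n) = (INR m ^ n)%R.
Proof. by elim: n => // n IH; rewrite expnS INR_muln IH. Qed.

Lemma INR_leq m n : m <= n -> (INR m <= INR n)%R.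
Proof. by move/leP; apply: le_INR. Qed.

Lemma INR_gt0 m : 0 < m -> (0 < INR m)%R.
Proof. by move/ltP; apply: lt_0_INR. Qed.

Lemma pow_succ_le_exp (u : R) (y : nat) : (0 <= u)%R -> ((1 + u) ^ y <= exp (INR y * u))%R.
Proof.
move=> u0; elim: y => [|y IH]; first by rewrite /= Rmult_0_l exp_0; lra.
rewrite S_INR Rmult_plus_distr_r Rmult_1_l exp_plus -tech_pow_Rmult Rmult_comm.
apply: Rmult_le_compat => //; [by apply: pow_le; lra | lra |].
exact: exp_ineq1_le.
Qed.

Lemma le_root_Rpower (s S m : nat) : expn s m.+1 <= S ->
  (INR s <= Rpower (INR S) (/ INR (m + 1)))%R.
Proof.
move=> le; rewrite addn1; case: s le => [|s] le.
  by apply: Rlt_le; apply: exp_pos.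
have s0 : (0 < INR s.+1)%R by apply: INR_gt0.
have m0 : (0 < INR m.+1)%R by apply: INR_gt0.
have {1}-> : INR s.+1 = Rpower (INR s.+1 ^ m.+1) (/ INR m.+1).
  rewrite -Rpower_pow // Rpower_mult Rinv_r ?Rpower_1 //; lra.
apply: Rle_Rpower_l; first by apply: Rlt_le; apply: Rinv_0_lt_compat.
by split; [apply: pow_lt | rewrite -INR_expn; apply: INR_leq].
Qed.

Lemma Rpower_root_ge1 (S m : nat) : 0 < S ->
  (1 <= Rpower (INR S) (/ INR (m + 1)))%R.
Proof.
by move=> S0; apply: (@le_root_Rpower 1); rewrite exp1n.
Qed.

Lemma trunc_log_le_ln (m : nat) : 0 < m -> (INR (trunc_log 2 m) <= 2 * ln (INR m))%R.
Proof.
move=> m0; set l := trunc_log 2 m.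
have h : (INR l * ln 2 <= ln (INR m))%R.
  rewrite -ln_pow; last lra.
  have -> : (2 ^ l)%R = INR (expn 2 l) by rewrite INR_expn.
  have le := INR_leq (trunc_logP (isT : 1 < 2) m0).
  case: (Rle_lt_or_eq_dec _ _ le) => [lt|->]; last exact: Rle_refl.
  apply: Rlt_le; apply: ln_increasing => //.
  by apply: INR_gt0; rewrite expn_gt0.
have := ln_lt_2; have := pos_INR l; nra.
Qed.

Lemma one_le_ln (m : nat) : 2 < m -> (1 <= ln (INR m))%R.
Proof.
move=> m2; rewrite -[X in (X <= _)%R]ln_exp.
have : (3 <= INR m)%R by have := INR_leq m2; rewrite /=; lra.
have := exp_le_3 => e3 m3; case: (Rle_lt_or_eq_dec (exp 1) (INR m)) => [|lt|->]; try lra.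
  by apply: Rlt_le; apply: ln_increasing => //; apply: exp_pos.
Qed.

(** [(1 + 1/W) ^ y <= exp (y / W) <= exp (1 / c0) <= 1 + mu]. *)
Lemma color_count_le (mu : R) (c0 W y k M : nat) : (0 < mu)%R -> (/ INR c0 <= ln (1 + mu))%R ->
  0 < c0 -> 0 < W -> c0 * y <= W -> expn W y * k <= expn W.+1 y * M ->
  (INR k <= (1 + mu) * INR M)%R.
Proof.
move=> mu0 c0mu c00 W0 c0y le.
have W0r := INR_gt0 W0; have c00r := INR_gt0 c00.
have {}le : (INR k <= (1 + / INR W) ^ y * INR M)%R.
  have := INR_leq le; rewrite !INR_muln !INR_expn S_INR => h.
  have Wy : (0 < INR W ^ y)%R by apply: pow_lt.
  apply: (Rmult_le_reg_l _ _ _ Wy); apply: Rle_trans h _.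
  rewrite -Rmult_assoc -Rpow_mult_distr.
  have -> : (INR W * (1 + / INR W) = INR W + 1)%R by field; lra.
  exact: Rle_refl.
apply: Rle_trans le _; apply: Rmult_le_compat_r; first exact: pos_INR.
have W0i : (0 < / INR W)%R by apply: Rinv_0_lt_compat.
apply: Rle_trans (pow_succ_le_exp y (Rlt_le _ _ W0i)) _.
rewrite -[X in (_ <= X)%R]exp_ln; last lra.
have le2 : (INR y * / INR W <= ln (1 + mu))%R.
  apply: Rle_trans c0mu; apply: (Rmult_le_reg_l (INR c0 * INR W)); first by nra.
  have := INR_leq c0y; rewrite INR_muln => h.
  have -> : (INR c0 * INR W * (INR y * / INR W) = INR c0 * INR y)%R by field; lra.
  have -> : (INR c0 * INR W * / INR c0 = INR W)%R by field; lra.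
  exact: h.
case: (Rle_lt_or_eq_dec _ _ le2) => [lt|->]; last exact: Rle_refl.
by apply: Rlt_le; apply: exp_increasing.
Qed.

(** Both alternatives give [s <= (K + 1) * lam ^ 4 * T], as [T >= 1]; the factor 3 covers the 8
    after squaring. *)
Lemma field_size_le (K D S s x Q lam : nat) : 0 < S -> 0 < lam ->
  expn Q 2 <= 8 * (D * s) -> expn s x.+1 <= S \/ s <= K * expn lam 4 ->
  (INR Q <= 3 * INR K.+1 * INR lam ^ 2 *
     sqrt (INR D * Rpower (INR S) (/ INR (x + 1))))%R.
Proof.
move=> S0 lam0 Qs sx; set T := Rpower _ _.
have T1 : (1 <= T)%R by apply: Rpower_root_ge1.
have l1 : (1 <= INR lam)%R by have := INR_leq lam0.
have l4 : (1 <= INR lam ^ 4)%R by apply: pow_R1_Rle.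
have K0 := pos_INR K; have D0 := pos_INR D; have s0 := pos_INR s.
have sT : (INR s <= INR K.+1 * INR lam ^ 4 * T)%R.
  rewrite S_INR; case: sx => [/le_root_Rpower|/INR_leq]; rewrite -/T.
    by have : (1 <= (INR K + 1) * INR lam ^ 4)%R; nra.
  rewrite INR_muln INR_expn => h.
  have : (0 <= INR K * INR lam ^ 4)%R by nra.
  nra.
have k1 : (1 <= INR K.+1)%R by rewrite S_INR; lra.
set X := (INR D * T)%R.
have X0 : (0 <= X)%R by rewrite /X; nra.
have sq := sqrt_sqrt X X0; have sq0 := sqrt_pos X.
have Q2 : (INR Q * INR Q <= 8 * (INR D * INR s))%R.
  have := INR_leq Qs; rewrite INR_expn !INR_muln /= Rmult_1_r; lra.
have Ds : (INR D * INR s <= INR K.+1 * INR lam ^ 4 * X)%R.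
  have : (INR D * INR s <= INR D * (INR K.+1 * INR lam ^ 4 * T))%R by apply: Rmult_le_compat_l.
  rewrite /X; lra.
set Y := (INR lam ^ 2)%R.
have YY : (INR lam ^ 4 = Y * Y)%R by rewrite /Y; ring.
have Y0 : (0 <= Y)%R by rewrite /Y; nra.
apply: Rsqr_incr_0_var; last first.
  apply: Rmult_le_pos sq0; apply: Rmult_le_pos Y0; lra.
rewrite /Rsqr; apply: Rle_trans Q2 _.
have -> : (3 * INR K.+1 * Y * sqrt X * (3 * INR K.+1 * Y * sqrt X) =
           9 * (INR K.+1 * INR K.+1) * (Y * Y * (sqrt X * sqrt X)))%R by ring.
rewrite sq -YY; have Z0 : (0 <= INR lam ^ 4 * X)%R by apply: Rmult_le_pos => //; lra.
rewrite Rmult_assoc in Ds; set U := (INR lam ^ 4 * X)%R in Ds Z0 *.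
have : (INR K.+1 * U <= INR K.+1 * INR K.+1 * U)%R.
  by apply: Rmult_le_compat_r => //; nra.
have : (0 <= INR K.+1 * INR K.+1 * U)%R by apply: Rmult_le_pos => //; nra.
lra.
Qed.

(** [C] is both the factor and the exponent. The polylogarithmic factor is [lam ^ 5 <= 32 * l ^ 5],
    so [C >= 5] suffices as exponent; [192 = 6 * 32], with 6 from [x + 1 <= 2 * x] and
    [field_size_le]. *)
Lemma round_count_le (K D Delta S s x r Q ls : nat) : 0 < S -> 0 < Delta -> 0 < x ->
  expn Q 2 <= 8 * (D * s) ->
  expn s x.+1 <= S \/ s <= K * expn (trunc_log 2 (Delta + 2)) 4 ->
  r <= ls + K * (x.+1 * (expn (trunc_log 2 (Delta + 2)) 3 * Q)) ->
  let C := 192 * (K * K.+1) + 5 in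
  (INR r <= INR C * INR x * sqrt (INR D * Rpower (INR S) (/ INR (x + 1)))
             * (ln (INR Delta + 2)) ^ C + INR C * INR ls)%R.
Proof.
move=> S0 D0 x0 Qs sx rle C; set lam := trunc_log _ _ in sx rle.
have lam0 : 0 < lam by rewrite trunc_log_gt0 // addn2.
have Qb := field_size_le S0 lam0 Qs sx.
set Z := sqrt _ in Qb *.
have Z0 : (0 <= Z)%R by apply: sqrt_pos.
have El : (INR Delta + 2 = INR (Delta + 2))%R by rewrite INR_addn.
rewrite El; have D2 : 2 < Delta + 2 by rewrite addnC -addn1 leq_add2l.
have l1 := one_le_ln D2; have ll := @trunc_log_le_ln (Delta + 2) (ltnW (ltnW D2)).
rewrite -/lam in ll; set l := ln _ in l1 ll *.
have lam0r := pos_INR lam; have K0 := pos_INR K; have x0r := pos_INR x.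
have ls0 := pos_INR ls; have x1 : (1 <= INR x)%R by have := INR_leq x0.
have C5 : (5 <= C)%coq_nat by apply/leP; rewrite /C leq_addl.
have l5 : (INR lam ^ 5 <= 32 * l ^ C)%R.
  apply: (Rle_trans _ ((2 * l) ^ 5)); first by apply: pow_incr.
  rewrite Rpow_mult_distr; have -> : (2 ^ 5 = 32)%R by ring.
  by apply: Rmult_le_compat_l; [lra | apply: Rle_pow].
have C1 : (192 * (INR K * INR K.+1) + 5 = INR C)%R.
  by rewrite /C INR_addn !INR_muln !INR_IZR_INZ.
have k1 := pos_INR K.+1.
have KK : (0 <= INR K * INR K.+1)%R by apply: Rmult_le_pos.
have lC : (0 <= l ^ C)%R by apply: pow_le; lra.
have h := INR_leq rle; rewrite INR_addn (INR_muln K) (INR_muln x.+1) (INR_muln (expn _ 3)) INR_expn S_INR in h.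
have Q0 := pos_INR Q.
have step : (INR K * ((INR x + 1) * (INR lam ^ 3 * INR Q)) <=
             192 * (INR K * INR K.+1) * INR x * Z * l ^ C)%R.
  apply: (Rle_trans _ (INR K * (2 * INR x * (INR lam ^ 3 * (3 * INR K.+1 * INR lam ^ 2 * Z))))).
    have l3 : (0 <= INR lam ^ 3)%R by apply: pow_le.
    apply: Rmult_le_compat_l => //; apply: Rmult_le_compat; try lra.
      by apply: Rmult_le_pos.
    exact: Rmult_le_compat_l.
  have -> : (INR K * (2 * INR x * (INR lam ^ 3 * (3 * INR K.+1 * INR lam ^ 2 * Z))) =
             6 * (INR K * INR K.+1) * INR x * Z * INR lam ^ 5)%R by ring.
  have -> : (192 * (INR K * INR K.+1) * INR x * Z * l ^ C =
             6 * (INR K * INR K.+1) * INR x * Z * (32 * l ^ C))%R by ring.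
  apply: Rmult_le_compat_l => //; apply: Rmult_le_pos => //; apply: Rmult_le_pos => //.
  lra.
have : (0 <= INR x * Z * l ^ C)%R by apply: Rmult_le_pos => //; apply: Rmult_le_pos.
rewrite -C1; nra.
Qed.

Theorem mainTheorem6 :
  forall (mu : R), (0 < mu)%R ->
  forall (c : nat), 1 <= c ->            (* IDs of O(log n) bits: IDs < n^c *)
  forall (g : nat -> nat), little_o_log g ->   (* x <= g(S) = o(log S) *)
  exists (C S0 : nat), forall (N n Delta D S x : nat),
    S0 <= S -> 1 <= x -> x <= g S -> N <= n ^ c ->
    exists (r : nat) (k : nat) (alg : graph N -> 'I_N -> nat),
      (INR r <= INR C * INR x
                 * sqrt (INR D * Rpower (INR S) (/ INR (x + 1)))
                 * (ln (INR Delta + 2)) ^ C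
               + INR C * INR (log_star n))%R /\
      (INR k <= (1 + mu) * INR S * INR D ^ (x + 1))%R /\
      local_algorithm (graph_class n Delta D S) r alg /\
      (forall G : graph N, graph_class n Delta D S G ->
         proper_coloring G (alg G) k).
Proof.
move=> mu mu0 c _ g _.
have lnmu : (0 < ln (1 + mu))%R by rewrite -ln_1; apply: ln_increasing; lra.
have [c0 c0P] := INR_unbounded (/ ln (1 + mu)).
have lni := Rinv_0_lt_compat _ lnmu.
have c00 : 0 < c0 by case: c0 c0P => //=; lra.
have c0mu : (/ INR c0 <= ln (1 + mu))%R.
  by rewrite -[X in (_ <= X)%R]Rinv_inv; apply: Rinv_le_contravar => //; lra.
have [K [S0 algo]] := bounded_diversity_coloring c c00.
(* The added 2 forces an edge, so [Delta >= 1] and [ln (Delta + 2) >= 1]. *)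
exists (192 * (K * K.+1) + 5), (S0 + 2) => N n Delta D S x Sbig x0 _ Nn.
have S2 : 1 < S by apply: leq_trans Sbig; rewrite addn2.
set C := 192 * (K * K.+1) + 5.
(* For an empty class the trivial algorithm works; a member of the class yields the inequalities
   between the parameters. *)
have [ne|empty] := Classical_Prop.classic (exists G : graph N, graph_class n Delta D S G);
    last first.
  exists 0, 0, (fun _ _ => 0).
  have noG (G : graph N) : graph_class n Delta D S G -> False by move=> cG; apply: empty; exists G.
  split; last split; last by split=> [G1 G2 v /noG|G /noG].
    have : (0 <= ln (INR Delta + 2))%R.
      rewrite -ln_1; case: (Req_dec 1 (INR Delta + 2)) => [->|ne]; first exact: Rle_refl.
      by apply: Rlt_le; apply: ln_increasing; have := pos_INR Delta; lra.
    move/(pow_le _ C) => lC; apply: Rplus_le_le_0_compat.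
      apply: Rmult_le_pos lC; apply: Rmult_le_pos (sqrt_pos _).
      by apply: Rmult_le_pos; apply: pos_INR.
    by apply: Rmult_le_pos; apply: pos_INR.
  apply: Rmult_le_pos; last by apply: pow_le; apply: pos_INR.
  by apply: Rmult_le_pos; [lra | apply: pos_INR].
rewrite pow_expn in Nn.
have S0S : S0 <= S by apply: leq_trans Sbig; rewrite leq_addr.
have [r [k [W [y [s [Q [col [lc rle [Qs sx] [W0 Wy] kle]]]]]]]] :=
  algo N n Delta D S x S0S Nn ne.
have D0 : 0 < Delta.
  by have [G cG] := ne; rewrite -ltnS (leq_trans S2) // (clique_number_le_degree cG) // ltnW.
exists r, k, col; split; last split; last split.
- exact: round_count_le (ltnW S2) D0 x0 Qs sx rle.
- have := color_count_le mu0 c0mu c00 W0 Wy kle.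
  by rewrite INR_muln INR_expn addn1; lra.
- exact: lc_local lc.
- move=> G cG; split=> [v vG|u v uG vG E]; first exact: (lc_bound lc cG vG).
  by apply: nesym; apply: (lc_proper lc cG); rewrite inE.
Qed.
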